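(* Assume that $A\neq0$, that there is $\nu>0$ with $\|A^{1/2}u\|^2\ge\nu\|u\|^2$ for all $u\in D(A^{1/2})\cap(\ker A)^\perp$, that $F$ satisfies (i)–(vi) of the context, and that $\gamma(t)=\alpha/t$, where either $\alpha\in\left(2,\frac{2s}{s-2}\right]$ and $s>6$, or $\alpha\in\left(\frac{s+2}{s-2},\frac{2s}{s-2}\right]$ and $s\le6$. Fix $$0<\varepsilon<\min\left\{\frac1{4(s-2)},\frac12\right\},\qquad 0<\epsilon_1\le\min\left\{\frac1{s^2},\frac{s-2}{2s^2+3s+2}\right\}.$$ Let $(u_0,u_1)\in(\mathcal H_1\times\mathcal H)\setminus(\ker A\times\ker A)$, let $u$ be the unique global mild solution of the Cauchy problem in the context, and let $K>0$ be a constant with $M_0(r)\le K$ for all $0\le r\le\sqrt{2E(t_0)}$. Put $$\bar C_1=2^{s/2}R\,(K^{\frac{s-2}{s}}+1),\qquad \bar C_3=\frac{8\nu+8}{\nu}\bar C_1 .$$ Then there is a constant $C_\varepsilon>0$, independent of $E(t_0)$ and $t_0$ once the bound $K$ is fixed, such that $$F(u(t))+\|A^{1/2}u(t)\|^2\le4\tilde H^*(t_0)t^{-\alpha+2\varepsilon}+C_\varepsilon t_0^{\alpha-\frac{2s}{s-2}-2\varepsilon}t^{-\alpha+2\varepsilon},\qquad\forall t\ge t_0,$$ and such that the following holds. Writing $[x]_+=\max\{x,0\}$, if $t_7\ge t_0$ is large enough that $$t_7^2\ge\max\left\{\frac{\alpha}{\nu}|\alpha-1|,\ \frac{\alpha}{2\nu}\left|\frac{\alpha}{2}+1\right|\right\},$$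 $$t_7\ge\frac{\nu^2+2\nu+3}{\nu\epsilon_1}\alpha+\left[\frac{4\bar C_1}{\epsilon_1\alpha}\Big([H^*(t_0)]_+^{\frac{s-2}{s}}+[H^*(t_0)]_+^{\frac{s-2}{2}}\Big)\right]^{\frac s2}+\left(\frac{8\bar C_1}{\epsilon_1\alpha}\right)^{s}\left[\tilde H^*(t_0)+C_\varepsilon t_0^{\alpha-\frac{2s}{s-2}-2\varepsilon}\right]_+^{s-2}$$ and $$t_7\ge\left[2\tilde H^*(t_0)\right]_+^{\frac{s+2}{\alpha}}+\left[2C_\varepsilon t_0^{\alpha-\frac{2s}{s-2}-2\varepsilon}\right]^{\frac{s(s+2)}{2\alpha}}+(16s\bar C_3)^{2s}+\frac{4\sqrt{2\nu+2}}{\nu},$$ then there is a constant $c>0$ such that $$E(t)\ge c\,t^{-\alpha},\qquad\forall t\ge t_7.$$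
   Context: $\mathcal H$ is a real Hilbert space with scalar product $\langle\cdot,\cdot\rangle$ and norm $\|\cdot\|$; $A$ is a nonnegative self-adjoint operator on $\mathcal H$ with dense domain $D(A)$ (not assumed coercive); $\mathcal H_1=D(A^{1/2})$ with norm $\|v\|_{\mathcal H_1}=(\|v\|^2+\|A^{1/2}v\|^2)^{1/2}$. $P:\mathcal H\to\ker A$ is the orthogonal projection and $Q=I-P$. Assumptions on $F$: (i) $F:\mathcal H_1\to\mathbb R$ is nonnegative and differentiable with $F(0)=0$, and its gradient is a map $\nabla F:\mathcal H_1\to\mathcal H$ (so $F'(u)h=\langle\nabla F(u),h\rangle$ for $u,h\in\mathcal H_1$). (ii) $\|\nabla F(v)-\nabla F(w)\|\le L_0(\|v\|_{\mathcal H_1},\|w\|_{\mathcal H_1})\|v-w\|_{\mathcal H_1}$ for all $v,w\in\mathcal H_1$, where $L_0$ is a positive function on $\mathbb R^+\times\mathbb R^+$ bounded on bounded sets. (iii) There is a constant $s>2$ with $sF(u)\le\langle\nabla F(u),u\rangle$ for all $u\in\mathcal H_1$. (iv) There is a constant $L_1>0$ with $\|\nabla F(v)-\nabla F(w)\|\le L_1\|v-w\|_{\mathcal H_1}(\|v\|_{\mathcal H_1}^{s-2}+\|w\|_{\mathcal H_1}^{s-2})$ for all $v,w\in\mathcal H_1$. (v) There is a function $M_0:\mathbb R\to\mathbb R$, bounded on bounded sets, with $\|u\|^s\le M_0(\|A^{1/2}u\|)(\|A^{1/2}u\|^2+F(u))$ for all $u\in\mathcal H_1$. (vi) There is $R>0$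 with $\|Q\nabla F(u)\|\le R(\|u\|^{s-2}+\|A^{1/2}u\|^{s-2})\|A^{1/2}u\|$ for all $u\in\mathcal H_1$. The number $s$ is the same in (iii)–(vi). Cauchy problem: $u''(t)+Au(t)+\gamma(t)u'(t)+\nabla F(u(t))=0$ for $t\ge t_0$, $u(t_0)=u_0$, $u'(t_0)=u_1$, where $t_0>0$ and $\gamma(t)=\alpha/t$. A mild solution is $u\in C([t_0,\infty);\mathcal H_1)\cap C^1([t_0,\infty);\mathcal H)$ with $$u(t)=S'(t-t_0)u_0+S(t-t_0)u_1-\int_{t_0}^tS(t-\tau)[\gamma(\tau)u'(\tau)+\nabla F(u(\tau))]\,d\tau,$$ where $S(\cdot)$ is the solution operator of $u''+Au=0$ with $S(0)=0$, $S'(0)=I$. For each $(u_0,u_1)\in\mathcal H_1\times\mathcal H$ a unique global mild solution exists. Energy: $E(t)=\frac12\|u'(t)\|^2+\frac12\|A^{1/2}u(t)\|^2+F(u(t))$; it is non-increasing, so $\|A^{1/2}u(t)\|\le\sqrt{2E(t_0)}$ for $t\ge t_0$. For $\lambda>0$, $\eta\in\mathbb R$ and $\xi=\lambda(\lambda+1-\alpha)$ set $E_\lambda(t)=t^2F(u(t))+\frac12\|\lambda u(t)+tu'(t)\|^2+\frac\xi2\|u(t)\|^2+\frac{t^2}2\|A^{1/2}u(t)\|^2$ and $H(t)=t^\eta E_\lambda(t)$. $H^*(t_0)$ denotes $H(t_0)$ with $\eta=\alpha-2$, $\lambda=\frac\alpha2$; $\tilde H^*(t_0)$ denotes $H(t_0)$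 with $\eta=\alpha-2-2\varepsilon$, $\lambda=\frac\alpha2+\varepsilon$. *)

(* Defs.v *)
From Stdlib Require Import Reals.
From Coquelicot Require Import Coquelicot.

Set Implicit Arguments.
Unset Strict Implicit.
Unset Printing Implicit Defensive.

Open Scope R_scope.

Record HilbertSpace := {
  hilbert_space :> CompleteNormedModule R_AbsRing;
  inner : hilbert_space -> hilbert_space -> R;
  inner_sym : forall x y, inner x y = inner y x;
  inner_plus_l : forall x y z, inner (plus x y) z = inner x z + inner y z;
  inner_scal_l : forall (a : R) x y, inner (scal a x) y = a * inner x y;
  inner_norm : forall x, inner x x = norm x ^ 2
}.

(* A possibly unbounded operator: the values of [op_fun] outside [dom] are
   irrelevant. *)
Record operator (H : HilbertSpace) := {
  dom : H -> Prop;
  op_fun :> H -> H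
}.

Section Operators.

Variable H : HilbertSpace.
Implicit Types (A B : operator H) (D : H -> Prop) (x y z : H).

Definition linear_operator A : Prop :=
  dom A zero /\
  (forall x y, dom A x -> dom A y ->
     dom A (plus x y) /\ A (plus x y) = plus (A x) (A y)) /\
  (forall (a : R) x, dom A x ->
     dom A (scal a x) /\ A (scal a x) = scal a (A x)).

Definition dense_set D : Prop :=
  forall x (eps : R), 0 < eps -> exists y, D y /\ norm (minus x y) < eps.

(* A is equal to its adjoint, as graphs: the left-hand side says that z = A* y. *)
Definition self_adjoint A : Prop :=
  linear_operator A /\ dense_set (dom A) /\
  forall y z,
    (forall x, dom A x -> inner (A x) y = inner x z) <->
    (dom A y /\ A y = z).

Definition nonneg_self_adjoint A : Prop :=
  self_adjoint A /\ forall x, dom A x -> 0 <= inner (A x) x.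

(* B = A^{1/2}: the (unique) nonnegative self-adjoint B with B o B = A, where
   B o B has its natural domain. *)
Definition is_sqrt_operator A B : Prop :=
  nonneg_self_adjoint B /\
  (forall x, dom A x <-> (dom B x /\ dom B (B x))) /\
  (forall x, dom A x -> A x = B (B x)).

Definition ker A x : Prop := dom A x /\ A x = zero.

Definition orth D x : Prop := forall y, D y -> inner x y = 0.

Definition is_orth_projection D (P : H -> H) : Prop :=
  forall x, D (P x) /\ orth D (minus x (P x)).

(* The norm of D(B) for the graph of B; with B = A^{1/2} it is the norm of H_1. *)
Definition norm1 B x : R := sqrt (norm x ^ 2 + norm (B x) ^ 2).

(* F is Frechet differentiable on the normed space D(B), with derivative
   h |-> <gradF u, h>. *)
Definition has_gradient B (F : H -> R) (gradF : H -> H) : Prop :=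
  forall u, dom B u -> forall eps : R, 0 < eps ->
    exists delta : R, 0 < delta /\
      forall h, dom B h -> norm1 B h <= delta ->
        Rabs (F (plus u h) - F u - inner (gradF u) h) <= eps * norm1 B h.

(* w is a classical solution, on the whole line, of w'' + A w = 0, with
   w' = dw, in C(D(A)) /\ C^1(D(B)) /\ C^2(H), where B = A^{1/2}. *)
Definition classical_wave_solution A B (w dw : R -> H) : Prop :=
  forall t : R,
  dom A (w t) /\ dom B (dw t) /\
  is_derive w t (dw t) /\
  is_derive dw t (opp (A (w t))) /\
  is_derive (fun r => B (w r)) t (B (dw t)) /\
  continuous (fun r => A (w r)) t /\
  continuous (fun r => B (dw r)) t.

(* S(t) is bounded on H; it is determined by the classical solutions with data
   (0, v), v in D(B), since D(B) is dense.  dS t v is S'(t) v for v in D(B). *)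
Definition is_solution_operator A B (S dS : R -> H -> H) : Prop :=
  (forall t, is_linear (S t)) /\
  forall v, dom B v ->
    classical_wave_solution A B (fun t => S t v) (fun t => dS t v) /\
    S 0 v = zero /\ dS 0 v = v.

(* The neighbourhoods of t in the half-line [t0, +oo). *)
Definition half_line_nbhs (t0 t : R) : (R -> Prop) -> Prop :=
  within (fun r => t0 <= r) (locally t).

(* u is in C([t0, oo); D(B)) and in C^1([t0, oo); H) with u' = du (one-sided
   at t0), and it satisfies Duhamel's formula. *)
Definition is_mild_solution B (S dS : R -> H -> H) (gradF : H -> H)
    (gamma : R -> R) (t0 : R) (u0 u1 : H) (u du : R -> H) : Prop :=
  forall t : R, t0 <= t ->
  dom B (u t) /\
  filterlim (fun r => norm1 B (minus (u r) (u t)))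
    (half_line_nbhs t0 t) (locally 0) /\
  filterdiff u (half_line_nbhs t0 t) (fun r : R => scal r (du t)) /\
  filterlim du (half_line_nbhs t0 t) (locally (du t)) /\
  let g := fun tau =>
    S (t - tau) (plus (scal (gamma tau) (du tau)) (gradF (u tau))) in
  ex_RInt g t0 t /\
  u t = minus (plus (dS (t - t0) u0) (S (t - t0) u1)) (RInt g t0 t).

Definition energy B (F : H -> R) (u du : R -> H) (t : R) : R :=
  / 2 * norm (du t) ^ 2 + / 2 * norm (B (u t)) ^ 2 + F (u t).

Definition energy_lambda B (F : H -> R) (alpha lambda : R) (u du : R -> H)
    (t : R) : R :=
  let xi := lambda * (lambda + 1 - alpha) in
  t ^ 2 * F (u t)
  + / 2 * norm (plus (scal lambda (u t)) (scal t (du t))) ^ 2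
  + xi / 2 * norm (u t) ^ 2
  + t ^ 2 / 2 * norm (B (u t)) ^ 2.

Definition energy_H B (F : H -> R) (alpha eta lambda : R) (u du : R -> H)
    (t : R) : R :=
  Rpower t eta * energy_lambda B F alpha lambda u du t.

Definition H_star B F alpha u du (t0 : R) : R :=
  energy_H B F alpha (alpha - 2) (alpha / 2) u du t0.

Definition H_star_tilde B F alpha eps u du (t0 : R) : R :=
  energy_H B F alpha (alpha - 2 - 2 * eps) (alpha / 2 + eps) u du t0.

End Operators.

(* x^p for x >= 0 and p > 0.  [Rpower 0 p] is 1, hence the case x = 0. *)
Definition rpow (x p : R) : R := if Rle_dec x 0 then 0 else Rpower x p.

Definition pos_part (x : R) : R := Rmax x 0.

Definition bounded_on_bounded_sets (f : R -> R) : Prop :=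
  forall r : R, exists M : R, forall x, Rabs x <= r -> Rabs (f x) <= M.

(* Main.v *)
Require Import Defs.
From Corelib Require Import ssreflect.
From Stdlib Require Import Reals Lra.
From Coquelicot Require Import Coquelicot.

Set Implicit Arguments.
Unset Strict Implicit.
Unset Printing Implicit Defensive.

(** Upper bound. Along a solution the functional E_lambda multiplied by t^eta has
    a derivative that can be computed exactly. With lambda = alpha/2 + eps and
    eta = alpha - 2 - 2 eps the coefficient of |lambda u + t u'|^2 vanishes,
    superlinearity of the gradient makes the potential term negative, and there
    is a spare -2 eps t^2 (F(u) + |A^(1/2) u|^2). The only other term is a
    multiple of |u|^2 of unfavourable sign; since |u|^s is controlled by
    F(u) + |A^(1/2) u|^2, it is absorbed up to t^(-4/(s-2))
    ([coercive_absorption]). The remainder is integrable at infinity because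
    alpha <= 2s/(s-2), which gives [upper_estimate].

    Lower bound. Let w = Q u be the component orthogonal to ker A and Q the
    orthogonal projection. It solves w'' + A w + (alpha/t) w' + Q grad F(u) = 0.
    By the bound on Q grad F the last term is at most g |A^(1/2) w| with g of
    order |u|^(s-2) + |A^(1/2) u|^(s-2), and the upper bound together with the
    restriction on alpha gives g = O(t^(-p)) with p > 1 ([decay_exponent]). So w
    is an integrable perturbation of a damped oscillation: its energy e satisfies
    e' = -(alpha/t) |w'|^2 + O(g) e, where |w'|^2 is on average equal to e, and
    the cross term (alpha/2t) <w, w'>, small against e because of the spectral
    gap, makes this averaging exact. Hence t^alpha e is bounded
    below by a positive constant ([oscillation_lower_bound]) unless it vanishes
    somewhere; e cannot vanish in finite time if it does not vanish initially
    ([oscillation_energy_pos]), and it vanishes initially only for data in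
    ker A x ker A ([oscillation_initial_energy]). Finally e <= E.

    Regularity. A mild solution is too rough for these computations: u' is in
    general not in the domain of A^(1/2). Two identities are needed, the
    derivatives of the energy and of <u, u'>. Duhamel's formula is first tested
    with vectors of the domain of A, which moves the solution operator onto the
    test vector, where it can be differentiated; this gives the weak form of the
    equation ([mild_weak]). The energy identity then follows from the weak form
    by averaging in time: the average of u' over [t, t + h] is a difference
    quotient of u, which is an admissible test vector ([energy_derivative]). *)

(** * Inner product spaces *)

Section Inner.

Variable H : HilbertSpace.
Implicit Types x y z : H.

Lemma inner_opp_l x z : inner (opp x) z = - inner x z.
Proof.
rewrite -(scal_opp_one x) inner_scal_l.
change (opp one : R) with (- (1)); ring.
Qed.

Lemma inner_minus_l x y z : inner (minus x y) z = inner x z - inner y z.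
Proof. rewrite /minus inner_plus_l inner_opp_l; ring. Qed.

Lemma inner_zero_l z : inner (zero : H) z = 0.
Proof.
rewrite -(scal_zero_l (z : H)) inner_scal_l.
change (zero : R) with 0; ring.
Qed.

Lemma inner_plus_r x y z : inner z (plus x y) = inner z x + inner z y.
Proof. by rewrite inner_sym inner_plus_l !(inner_sym z). Qed.

Lemma inner_scal_r (a : R) x z : inner z (scal a x) = a * inner z x.
Proof. by rewrite inner_sym inner_scal_l !(inner_sym z). Qed.

Lemma inner_opp_r x z : inner z (opp x) = - inner z x.
Proof. by rewrite inner_sym inner_opp_l !(inner_sym z). Qed.

Lemma inner_minus_r x y z : inner z (minus x y) = inner z x - inner z y.
Proof. by rewrite inner_sym inner_minus_l !(inner_sym z). Qed.

Lemma inner_zero_r z : inner z (zero : H) = 0.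
Proof. by rewrite inner_sym inner_zero_l. Qed.

Lemma inner_self_eq0 x : inner x x = 0 -> x = zero.
Proof.
rewrite inner_norm => h; apply: norm_eq_zero.
have := norm_ge_0 (x : H); nra.
Qed.

Lemma inner_ext x y : (forall z, inner x z = inner y z) -> x = y.
Proof.
move=> h; have h0 : minus x y = zero.
  by apply: inner_self_eq0; rewrite inner_minus_l h; ring.
by rewrite -(plus_zero_r y) -h0 /minus plus_comm -plus_assoc plus_opp_l plus_zero_r.
Qed.

End Inner.

Ltac inner_expand :=
  rewrite ?(inner_minus_l, inner_minus_r, inner_plus_l, inner_plus_r,
            inner_scal_l, inner_scal_r, inner_opp_l, inner_opp_r,
            inner_zero_l, inner_zero_r).

(** Tested against an arbitrary vector, an identity between linear combinations
    becomes a scalar identity. *)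
Ltac vec := apply: inner_ext => ?; inner_expand; try ring; try (field; lra).

Section Norm.

Variable H : HilbertSpace.
Implicit Types x y z : H.

Lemma cauchy_schwarz x y : Rabs (inner x y) <= norm x * norm y.
Proof.
have hx := norm_ge_0 (x : H); have hy := norm_ge_0 (y : H).
have hp := Rmult_le_pos _ _ hx hy.
suff h : (inner x y) ^ 2 <= (norm x * norm y) ^ 2 by apply: Rabs_le; nra.
have e := inner_norm (minus (scal (norm y ^ 2) x) (scal (inner x y) y)).
move: e; inner_expand; rewrite !inner_norm (inner_sym y x) => e.
have h0 := pow2_ge_0 (norm (minus (scal (norm y ^ 2) x) (scal (inner x y) y))).
case: (Req_dec (norm y) 0) => hy0.
  have -> : y = zero by apply: norm_eq_zero.
  by rewrite inner_zero_r norm_zero; lra.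
have h1 : 0 < norm y ^ 2 by apply: pow_lt; lra.
apply: (Rmult_le_reg_l (norm y ^ 2)) => //; nra.
Qed.

End Norm.

(** * Limits and derivatives of vector-valued functions *)

Section Limits.

Context {V : NormedModule R_AbsRing} {T : Type} {FT : (T -> Prop) -> Prop}
  {FF : Filter FT}.

Lemma filterlim_normP (f : T -> V) (l : V) :
  filterlim f FT (locally l) <->
  forall e : R, 0 < e -> FT (fun x => norm (minus (f x) l) < e).
Proof.
rewrite filterlim_locally_ball_norm; split => h e.
  by move=> he; apply: (h (mkposreal e he)).
by apply: h; apply: cond_pos.
Qed.

Lemma filterlim_RP (f : T -> R) (l : R) :
  filterlim f FT (locally l) <->
  forall e : R, 0 < e -> FT (fun x => Rabs (f x - l) < e).
Proof.
rewrite filterlim_locally; split => h e.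
  by move=> he; apply: (h (mkposreal e he)).
by apply: h; apply: cond_pos.
Qed.

Lemma filterlim_plus_fun (f g : T -> V) a b :
  filterlim f FT (locally a) -> filterlim g FT (locally b) ->
  filterlim (fun x => plus (f x) (g x)) FT (locally (plus a b)).
Proof. by move=> hf hg; apply: (filterlim_comp_2 f g (@plus V) hf hg); apply: filterlim_plus. Qed.

Lemma filterlim_scal_fun (f : T -> R) (g : T -> V) a b :
  filterlim f FT (locally a) -> filterlim g FT (locally b) ->
  filterlim (fun x => scal (f x) (g x)) FT (locally (scal a b)).
Proof.
by move=> hf hg; apply: (filterlim_comp_2 f g (@scal _ V) hf hg); apply: (filterlim_scal (K := R_AbsRing)).
Qed.

Lemma filterlim_minus_fun (f g : T -> V) a b :
  filterlim f FT (locally a) -> filterlim g FT (locally b) ->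
  filterlim (fun x => minus (f x) (g x)) FT (locally (minus a b)).
Proof.
move=> hf hg; apply: filterlim_plus_fun => //.
by apply: (filterlim_comp _ _ _ _ _ _ _ _ hg); apply: filterlim_opp.
Qed.

Lemma filterlim_norm_fun (f : T -> V) a :
  filterlim f FT (locally a) ->
  filterlim (fun x => norm (f x)) FT (locally (norm a)).
Proof. by move=> hf; apply: (filterlim_comp _ _ _ _ _ _ _ _ hf); apply: filterlim_norm. Qed.

Lemma filterlim_norm_minus (f : T -> V) (l : V) :
  filterlim (fun x => norm (minus (f x) l)) FT (locally 0) ->
  filterlim f FT (locally l).
Proof.
move=> h; apply/filterlim_normP => e he.
move/filterlim_RP: h => /(_ e he); apply: filter_imp => x.
by rewrite Rminus_0_r Rabs_pos_eq //; apply: norm_ge_0.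
Qed.

Lemma filterlim_squeeze0 (f g : T -> R) :
  FT (fun x => Rabs (f x) <= g x) -> filterlim g FT (locally 0) ->
  filterlim f FT (locally 0).
Proof.
move=> hfg /filterlim_RP hg; apply/filterlim_RP => e he.
apply: (filter_imp _ _ _ (filter_and _ _ hfg (hg e he))) => x [h1 h2].
move: h2; rewrite !Rminus_0_r => h2; have := Rle_abs (g x); lra.
Qed.

Lemma filterlim_Rplus (f g : T -> R) a b :
  filterlim f FT (locally a) -> filterlim g FT (locally b) ->
  filterlim (fun x => f x + g x) FT (locally (a + b)).
Proof.
move=> hf hg; apply: (filterlim_comp_2 f g Rplus hf hg).
exact: (filterlim_plus (V := R_NormedModule)).
Qed.

Lemma filterlim_Rmult (f g : T -> R) a b :
  filterlim f FT (locally a) -> filterlim g FT (locally b) ->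
  filterlim (fun x => f x * g x) FT (locally (a * b)).
Proof.
move=> hf hg; apply: (filterlim_comp_2 f g Rmult hf hg).
exact: (filterlim_scal (K := R_AbsRing) (V := R_NormedModule)).
Qed.

Lemma filterlim_Rminus (f g : T -> R) a b :
  filterlim f FT (locally a) -> filterlim g FT (locally b) ->
  filterlim (fun x => f x - g x) FT (locally (a - b)).
Proof.
move=> hf hg; apply: filterlim_Rplus => //.
apply: (filterlim_comp _ _ _ _ _ _ _ _ hg).
exact: (filterlim_opp (V := R_NormedModule)).
Qed.

End Limits.

Section InnerLimits.

Variable H : HilbertSpace.

Lemma filterlim_inner {T : Type} {FT : (T -> Prop) -> Prop} {FF : Filter FT}
    (f g : T -> H) (a b : H) :
  filterlim f FT (locally a) -> filterlim g FT (locally b) ->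
  filterlim (fun x => inner (f x) (g x)) FT (locally (inner a b)).
Proof.
have polar (x y : H) :
    inner x y = / 4 * (norm (plus x y) * norm (plus x y)
                       - norm (minus x y) * norm (minus x y)).
  have h1 := inner_norm (plus x y); have h2 := inner_norm (minus x y).
  move: h1 h2; inner_expand; rewrite (inner_sym y x) => h1 h2; lra.
move=> hf hg.
apply: (filterlim_ext (fun x => / 4 * (norm (plus (f x) (g x)) * norm (plus (f x) (g x))
     - norm (minus (f x) (g x)) * norm (minus (f x) (g x))))).
  by move=> x; rewrite polar.
rewrite polar; apply: filterlim_Rmult; first exact: filterlim_const.
have h1 := filterlim_norm_fun (filterlim_plus_fun (FF := FF) hf hg).
have h2 := filterlim_norm_fun (filterlim_minus_fun (FF := FF) hf hg).
by apply: filterlim_Rminus; apply: filterlim_Rmult.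
Qed.

Lemma continuous_inner (U : UniformSpace) (f g : U -> H) (x : U) :
  continuous f x -> continuous g x -> continuous (fun y => inner (f y) (g y)) x.
Proof. exact: filterlim_inner. Qed.

End InnerLimits.

Section Derive.

Context {V : NormedModule R_AbsRing}.

Lemma norm_scal_eq (a : R) (x : V) : norm (scal a x) = Rabs a * norm x.
Proof.
apply: Rle_antisym; first exact: norm_scal.
case: (Req_dec a 0) => [->|ha].
  by rewrite Rabs_R0 Rmult_0_l; apply: norm_ge_0.
have h : norm x <= Rabs (/ a) * norm (scal a x).
  have {1}-> : x = scal (/ a) (scal a x).
    rewrite scal_assoc; change (mult (/ a) a) with (/ a * a).
    by rewrite Rinv_l // (scal_one x).
  exact: norm_scal.
rewrite Rabs_inv in h.
have ha' := Rabs_pos_lt _ ha.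
apply: (Rmult_le_reg_l (/ Rabs a)); first exact: Rinv_0_lt_compat.
by rewrite -Rmult_assoc Rinv_l ?Rmult_1_l //; lra.
Qed.

(** As a limit of difference quotients the derivative of a product of any kind
    follows from the continuity of that product. *)
Definition diff_quot (f : R -> V) (x y : R) : V := scal (/ (y - x)) (minus (f y) (f x)).

Lemma diff_quot_error (f : R -> V) (l : V) x y : y <> x ->
  norm (minus (minus (f y) (f x)) (scal (y - x) l)) =
  Rabs (y - x) * norm (minus (diff_quot f x y) l).
Proof.
move=> hxy; rewrite -norm_scal_eq; congr norm.
rewrite /diff_quot /minus scal_distr_l scal_assoc.
change (mult (y - x) (/ (y - x))) with ((y - x) * / (y - x)).
by rewrite Rinv_r ?(scal_one (plus (f y) _)) ?scal_opp_r //; lra.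
Qed.

Lemma is_derive_quotP (f : R -> V) (x : R) (l : V) :
  is_derive f x l <-> filterlim (diff_quot f x) (locally' x) (locally l).
Proof.
split.
- move=> [_ h]; apply/filterlim_normP => e he.
  have he2 : 0 < e / 2 by lra.
  have := h x (fun P hP => hP) (mkposreal _ he2); rewrite /locally' /within.
  apply: filter_imp => y /= hy hxy.
  move: hy; change (minus y x) with (y - x); change (norm (y - x)) with (Rabs (y - x)).
  rewrite diff_quot_error // => hy.
  have hp : 0 < Rabs (y - x) by apply: Rabs_pos_lt; lra.
  apply: (Rle_lt_trans _ (e / 2)); last lra.
  by apply: (Rmult_le_reg_l (Rabs (y - x))) => //; lra.
- move=> /filterlim_normP h; split; first exact: is_linear_scal_l.
  move=> x' hx'; have -> : x' = x by rewrite (is_filter_lim_locally_unique x x' hx').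
  move=> e; have := h e (cond_pos e); rewrite /locally' /within.
  apply: filter_imp => y hy.
  change (minus y x) with (y - x); change (norm (y - x)) with (Rabs (y - x)).
  case: (Req_dec y x) => [->|hxy].
    rewrite Rminus_diag Rabs_R0 Rmult_0_r (scal_zero_l l) /minus plus_opp_r plus_opp_r.
    by rewrite norm_zero; lra.
  rewrite diff_quot_error // Rmult_comm.
  by apply: Rmult_le_compat_r; [apply: Rabs_pos | left; apply: hy].
Qed.

Lemma is_derive_continuous (f : R -> V) x l : is_derive f x l -> continuous f x.
Proof. by move=> h; apply: ex_derive_continuous; exists l. Qed.

Lemma continuous_punctured (f : R -> V) x :
  continuous f x -> filterlim f (locally' x) (locally (f x)).
Proof. by move=> h; apply: (filterlim_filter_le_1 _ _ h); apply: filter_le_within. Qed.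

End Derive.

Section InnerDerive.

Variable H : HilbertSpace.
Implicit Types f g : R -> H.

Lemma is_derive_inner f g x (f' g' : H) :
  is_derive f x f' -> is_derive g x g' ->
  is_derive (fun y => inner (f y) (g y)) x (inner f' (g x) + inner (f x) g').
Proof.
move=> hf hg; apply/is_derive_quotP.
apply: (filterlim_ext_loc
  (fun y => inner (diff_quot f x y) (g y) + inner (f x) (diff_quot g x y))).
  rewrite /locally' /within; apply: filter_forall => y hxy.
  rewrite /diff_quot; inner_expand.
  change (scal (/ (y - x)) (minus (inner (f y) (g y)) (inner (f x) (g x))))
    with (/ (y - x) * (inner (f y) (g y) - inner (f x) (g x))); ring.
apply: filterlim_Rplus; apply: filterlim_inner.
- exact/is_derive_quotP.
- by apply: continuous_punctured; apply: is_derive_continuous hg.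
- exact: filterlim_const.
- exact/is_derive_quotP.
Qed.

Lemma is_derive_inner_const f x (f' z : H) :
  is_derive f x f' -> is_derive (fun y => inner (f y) z) x (inner f' z).
Proof.
move=> hf; have := is_derive_inner hf (is_derive_const z x).
by rewrite inner_zero_r Rplus_0_r.
Qed.

Lemma is_derive_norm_sq f x (f' : H) :
  is_derive f x f' -> is_derive (fun y => norm (f y) ^ 2) x (2 * inner f' (f x)).
Proof.
move=> hf; apply: (is_derive_ext (fun y => inner (f y) (f y))).
  by move=> y; rewrite inner_norm.
have -> : 2 * inner f' (f x) = inner f' (f x) + inner (f x) f'.
  by rewrite (inner_sym (f x)); ring.
exact: is_derive_inner.
Qed.

End InnerDerive.

(** * Mean values and integrals depending on a parameter *)

Lemma mean_value (f df : R -> R) a b :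
  (forall x, Rmin a b <= x <= Rmax a b -> is_derive f x (df x)) ->
  exists c, Rmin a b <= c <= Rmax a b /\ f b - f a = df c * (b - a).
Proof.
move=> h; apply: (MVT_gen f a b df) => x hx; first by apply: h; lra.
by apply/continuity_pt_filterlim; apply: is_derive_continuous (h x hx).
Qed.

Lemma nondecreasing_of_derive (f df : R -> R) a b :
  a <= b ->
  (forall x, a <= x <= b -> continuous f x) ->
  (forall x, a < x < b -> is_derive f x (df x)) ->
  (forall x, a < x < b -> 0 <= df x) -> f a <= f b.
Proof.
move=> hab hc hd hp; case: (Req_dec a b) => [<-|hne]; first lra.
(* the derivative is only known to be nonnegative inside the interval *)
pose dg x := if Rlt_dec a x is left _ then (if Rlt_dec x b is left _ then df x else 0) else 0.
have dg0 x : 0 <= dg x.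
  rewrite /dg; case: Rlt_dec => h1; last lra.
  by case: Rlt_dec => h2; [apply: hp | lra].
have [c [_ hc']] : exists c, Rmin a b <= c <= Rmax a b /\ f b - f a = dg c * (b - a).
  apply: MVT_gen; rewrite (Rmin_left _ _ hab) (Rmax_right _ _ hab) => x hx.
    rewrite /dg; case: Rlt_dec => h1; last lra.
    by case: Rlt_dec => h2; [apply: hd | lra].
  by apply/continuity_pt_filterlim; apply: hc.
have := dg0 c; nra.
Qed.

Section HilbertMean.

Variable H : HilbertSpace.

(** The scalar mean value theorem, applied after testing with the error vector
    itself. *)
Lemma mean_value_bound (f df : R -> H) (c : H) a b e : a < b -> 0 <= e ->
  (forall x, a <= x <= b -> is_derive f x (df x)) ->
  (forall x, a <= x <= b -> norm (minus (df x) c) <= e) ->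
  norm (minus (scal (/ (b - a)) (minus (f b) (f a))) c) <= e.
Proof.
move=> hab he hd hb.
have [D eD] : exists D, D = minus (scal (/ (b - a)) (minus (f b) (f a))) c by eexists.
rewrite -eD.
have hmin : Rmin a b = a by apply: Rmin_left; lra.
have hmax : Rmax a b = b by apply: Rmax_right; lra.
have [x [hx e1]] : exists x, Rmin a b <= x <= Rmax a b /\
    inner (f b) D - inner (f a) D = inner (df x) D * (b - a).
  apply: (mean_value (f := fun y => inner (f y) D) (df := fun y => inner (df y) D)) => x hx.
  by apply: is_derive_inner_const; apply: hd; lra.
have hD : norm D ^ 2 = inner (minus (df x) c) D.
  rewrite -inner_norm {1}eD; inner_expand; rewrite e1; field; lra.
have h1 := cauchy_schwarz (minus (df x) c) D.
have h2 := hb x ltac:(lra).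
have h3 := Rle_abs (inner (minus (df x) c) D).
have h4 := norm_ge_0 D.
case: (Rle_dec (norm D) e) => // hn; nra.
Qed.

Lemma is_RInt_inner (g : R -> H) a b (I z : H) :
  is_RInt g a b I -> is_RInt (fun x => inner (g x) z) a b (inner I z).
Proof.
move=> h; rewrite /is_RInt.
apply: (filterlim_ext (fun p => inner (scal (sign (b - a)) (Riemann_sum g p)) z)).
  move=> p; rewrite inner_scal_l.
  change (scal (sign (b - a)) (Riemann_sum (fun x => inner (g x) z) p))
    with (sign (b - a) * Riemann_sum (fun x => inner (g x) z) p).
  congr (_ * _); move: p; apply: (SF_cons_ind (T := R)) => [x0|x0 p IH].
    exact: inner_zero_l.
  by rewrite !Riemann_sum_cons inner_plus_l inner_scal_l IH.
by apply: filterlim_inner => //; apply: filterlim_const.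
Qed.

(** Leibniz' rule for a convolution; the kernel is only tested against a
    continuous vector function, so real integrals suffice. *)
Lemma is_derive_convolution (f Phi dPhi : R -> H) t0 t :
  (forall r, continuous f r) ->
  (forall r, is_derive Phi r (dPhi r)) ->
  (forall r, continuous dPhi r) ->
  is_derive (fun t => RInt (fun r => inner (f r) (Phi (t - r))) t0 t) t
    (inner (f t) (Phi 0) + RInt (fun r => inner (f r) (dPhi (t - r))) t0 t).
Proof.
move=> cf dP cdP.
have cP r : continuous Phi r by apply: is_derive_continuous (dP r).
have dk x y : is_derive (fun z => inner (f y) (Phi (z - y))) x (inner (f y) (dPhi (x - y))).
  apply: (is_derive_ext (fun z => inner (Phi (z - y)) (f y))).
    by move=> z; apply: inner_sym.
  rewrite inner_sym; apply: is_derive_inner_const.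
  have h : is_derive (fun z : R => z - y) x 1 by auto_derive; lra.
  have := is_derive_comp Phi (fun z => z - y) x _ _ (dP (x - y)) h.
  by rewrite (scal_one (dPhi (x - y))).
have ck x y : continuous (fun r => inner (f r) (Phi (x - r))) y.
  apply: continuous_inner; first exact: cf.
  apply: continuous_comp; last exact: cP.
  by apply: ex_derive_continuous; auto_derive.
have c2 x y : continuity_2d_pt (fun u v => Derive (fun z => inner (f v) (Phi (z - v))) u) x y.
  apply: (continuity_2d_pt_ext (fun u v => inner (f v) (dPhi (u - v)))).
    by move=> u v; rewrite (is_derive_unique _ _ _ (dk u v)).
  apply/continuity_2d_pt_filterlim.
  apply: (continuous_inner (U := prod_UniformSpace R_UniformSpace R_UniformSpace)
    (f := fun z => f (snd z)) (g := fun z => dPhi (fst z - snd z)) (x := (x, y))).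
    by apply: continuous_comp; [apply: continuous_snd | apply: cf].
  apply: (continuous_comp (fun z : R * R => fst z - snd z) dPhi); last exact: cdP.
  by apply: (continuous_minus (V := R_NormedModule));
    [apply: continuous_fst | apply: continuous_snd].
have ei x a b : ex_RInt (fun r => inner (f r) (Phi (x - r))) a b.
  by apply: ex_RInt_continuous => z _; apply: ck.
have := is_derive_RInt_param_bound_comp
  (fun z r => inner (f r) (Phi (z - r))) (fun _ => t0) (fun z => z) t 0 1.
have -> : RInt (fun r => Derive (fun u => inner (f r) (Phi (u - r))) t) t0 t +
    - inner (f t0) (Phi (t - t0)) * 0 + inner (f t) (Phi (t - t)) * 1
  = inner (f t) (Phi 0) + RInt (fun r => inner (f r) (dPhi (t - r))) t0 t.
  rewrite Rminus_diag.
  rewrite (RInt_ext _ (fun r => inner (f r) (dPhi (t - r)))); first ring.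
  by move=> r _; apply: is_derive_unique.
apply.
- exact: filter_forall.
- by exists (mkposreal 1 Rlt_0_1); apply: filter_forall.
- by exists (mkposreal 1 Rlt_0_1); apply: filter_forall.
- exact: is_derive_const.
- exact: is_derive_id.
- exists (mkposreal 1 Rlt_0_1); apply: filter_forall => x r _.
  by exists (inner (f r) (dPhi (x - r))).
- by move=> r _.
- by exists (mkposreal 1 Rlt_0_1) => u v _ _.
- by exists (mkposreal 1 Rlt_0_1) => u v _ _.
- by apply/continuity_pt_filterlim; apply: ck.
- by apply/continuity_pt_filterlim; apply: ck.
Qed.

End HilbertMean.

(** * Self-adjoint operators, square roots and the projection onto the kernel *)

Section SelfAdjoint.

Variable H : HilbertSpace.
Implicit Types (A B : operator H) (x y : H).

Lemma self_adjoint_sym B x y : self_adjoint B -> dom B x -> dom B y ->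
  inner (B x) y = inner x (B y).
Proof. by move=> [_ [_ h]] hx hy; apply: (proj2 (h y (B y)) (conj hy eq_refl)). Qed.

Lemma op_plus B x y : self_adjoint B -> dom B x -> dom B y ->
  dom B (plus x y) /\ B (plus x y) = plus (B x) (B y).
Proof. by move=> [[_ [h _]] _]; apply: h. Qed.

Lemma op_scal B (a : R) x : self_adjoint B -> dom B x ->
  dom B (scal a x) /\ B (scal a x) = scal a (B x).
Proof. by move=> [[_ [_ h]] _]; apply: h. Qed.

Lemma op_minus B x y : self_adjoint B -> dom B x -> dom B y ->
  dom B (minus x y) /\ B (minus x y) = minus (B x) (B y).
Proof.
move=> sB hx hy; rewrite /minus -(scal_opp_one y) -(scal_opp_one (B y)).
have [h1 h2] := op_scal (opp one) sB hy.
by have [h3 h4] := op_plus sB hx h1; rewrite h4 h2.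
Qed.

Lemma op_zero B : self_adjoint B -> dom B zero /\ B zero = zero.
Proof.
move=> sB; have [[h0 _] _] := sB; split => //.
have [_ h] := op_scal 0 sB h0; move: h.
by rewrite (scal_zero_l (zero : H)) (scal_zero_l (B zero)).
Qed.

Lemma orth_dense D x : dense_set D -> (forall y, D y -> inner x y = 0) -> x = zero.
Proof.
move=> hD h; apply: inner_self_eq0; apply: cond_eq => e he.
have hn := norm_ge_0 (x : H).
have he' : 0 < e / (norm x + 1) by apply: Rdiv_lt_0_compat; lra.
have [y [hy hxy]] := hD x _ he'.
have -> : inner x x - 0 = inner x (minus x y) by inner_expand; rewrite (h y hy).
have h1 := cauchy_schwarz x (minus x y).
have h2 : norm x * norm (minus x y) <= norm x * (e / (norm x + 1)).
  by apply: Rmult_le_compat_l; lra.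
have h3 : (norm x + 1) * (e / (norm x + 1)) = e by field; lra.
lra.
Qed.

(** Adjunction identities for a bounded operator extend from a dense set, in the
    argument that the operator acts on. *)
Lemma linear_dense_adjoint D (L : H -> H) (y z : H) :
  dense_set D -> is_linear L ->
  (forall x, D x -> inner (L x) y = inner x z) ->
  forall x, inner (L x) y = inner x z.
Proof.
move=> hD hL h x; apply: cond_eq => e he.
have [M [hM hb]] := linear_norm _ hL.
have hy := norm_ge_0 (y : H); have hz := norm_ge_0 (z : H).
have hMy := Rmult_le_pos _ _ (Rlt_le _ _ hM) hy.
pose k := M * norm y + norm z + 1.
have hk : 0 < k by rewrite /k; lra.
have [w [hw hxw]] := hD x _ (Rdiv_lt_0_compat _ _ he hk).
have hl : L x = plus (L w) (L (minus x w)).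
  rewrite -(linear_plus _ hL); congr L; vec.
have -> : inner (L x) y - inner x z = inner (L (minus x w)) y - inner (minus x w) z.
  by rewrite hl; inner_expand; rewrite (h w hw); ring.
have h1 := cauchy_schwarz (L (minus x w)) y.
have h2 := cauchy_schwarz (minus x w) z.
have h3 := Rmult_le_compat_r _ _ _ hy (hb (minus x w)).
have h4 := Rabs_triang (inner (L (minus x w)) y) (- inner (minus x w) z).
rewrite Rabs_Ropp in h4.
have h5 : norm (minus x w) * k < e.
  apply: (Rmult_lt_reg_r (/ k)); first exact: Rinv_0_lt_compat.
  by rewrite Rmult_assoc Rinv_r ?Rmult_1_r //; lra.
have h6 := norm_ge_0 (minus x w).
by rewrite /k in h5; rewrite /Rminus; nra.
Qed.

Section SquareRoot.

Variables A B : operator H.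
Hypotheses (sA : self_adjoint A) (hB : is_sqrt_operator A B).

Lemma sqrt_self_adjoint : self_adjoint B.
Proof. by case: hB => [[]]. Qed.

Lemma sqrt_dom x : dom A x -> dom B x /\ dom B (B x) /\ A x = B (B x).
Proof. by case: hB => _ [h1 h2] hx; have [h3 h4] := proj1 (h1 x) hx; do 2 split => //; apply: h2. Qed.

Lemma inner_sqrt x y : dom A x -> dom B y -> inner (A x) y = inner (B x) (B y).
Proof.
by move=> hx hy; have [h1 [h2 ->]] := sqrt_dom hx; apply: self_adjoint_sym => //; case: hB => [[]].
Qed.

Lemma ker_sqrt x : ker A x <-> dom B x /\ B x = zero.
Proof.
split => [[hx h0]|[hx h0]].
- have [h1 [h2 h3]] := sqrt_dom hx; split => //.
  by apply: inner_self_eq0; rewrite -(inner_sqrt hx h1) h0 inner_zero_l.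
- have [z1 z2] := op_zero sqrt_self_adjoint.
  have hA : dom A x by apply/(proj1 (proj2 hB)); rewrite h0.
  by split => //; have [_ [_ ->]] := sqrt_dom hA; rewrite h0.
Qed.

End SquareRoot.

Section Projection.

Variables (A : operator H) (P : H -> H).
Hypotheses (sA : self_adjoint A) (hP : is_orth_projection (ker A) P).

(** The projection Q = I - P. *)
Definition coproj x := minus x (P x).

(** Linearity and continuity of the projection all follow from its symmetry, since
    it is given only through orthogonality. *)
Lemma coproj_sym x y : inner (coproj x) y = inner x (coproj y).
Proof.
have [hx ox] := hP x; have [hy oy] := hP y.
have e1 := ox _ hy; have e2 := oy _ hx; rewrite /coproj.
move: e1 e2; inner_expand; rewrite (inner_sym y (P x)) (inner_sym (P y) (P x)); lra.
Qed.

Lemma coproj_orth x : orth (ker A) (coproj x).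
Proof. by have [_ ox] := hP x. Qed.

Lemma coproj_linear (a : R) x y :
  coproj (plus (scal a x) y) = plus (scal a (coproj x)) (coproj y).
Proof. by apply: inner_ext => z; rewrite coproj_sym 2!inner_plus_l 2!inner_scal_l 2!coproj_sym. Qed.

Lemma coproj_scal (a : R) x : coproj (scal a x) = scal a (coproj x).
Proof. by apply: inner_ext => z; rewrite coproj_sym 2!inner_scal_l coproj_sym. Qed.

Lemma coproj_minus x y : coproj (minus x y) = minus (coproj x) (coproj y).
Proof. by apply: inner_ext => z; rewrite coproj_sym 2!inner_minus_l 2!coproj_sym. Qed.

Lemma coproj_norm x : norm (coproj x) <= norm x.
Proof.
have [hpx ox] := hP x.
have e : inner (coproj x) (coproj x) = inner x (coproj x).
  by rewrite {2}/coproj inner_minus_r (ox _ hpx) inner_sym; ring.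
rewrite inner_norm in e; have h1 := cauchy_schwarz x (coproj x).
have h2 := norm_ge_0 (coproj x); have h3 := norm_ge_0 (x : H).
have h4 := Rle_abs (inner x (coproj x)).
case: (Rle_dec (norm (coproj x)) (norm x)) => // hn; nra.
Qed.

Lemma filterlim_coproj {T : Type} {FT : (T -> Prop) -> Prop} {FF : Filter FT}
    (f : T -> H) (l : H) :
  filterlim f FT (locally l) ->
  filterlim (fun r => coproj (f r)) FT (locally (coproj l)).
Proof.
move=> /filterlim_normP h; apply/filterlim_normP => e he.
apply: (filter_imp _ _ _ (h e he)) => x hx; rewrite -coproj_minus.
exact: Rle_lt_trans (coproj_norm _) hx.
Qed.

Lemma is_derive_coproj (f : R -> H) (t : R) (l : H) :
  is_derive f t l -> is_derive (fun r => coproj (f r)) t (coproj l).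
Proof.
move=> /is_derive_quotP h; apply/is_derive_quotP.
apply: (filterlim_ext _ _ _ (filterlim_coproj h)) => y.
by rewrite /diff_quot coproj_scal coproj_minus.
Qed.

Lemma coproj_sqrt B x : is_sqrt_operator A B -> dom B x ->
  dom B (coproj x) /\ B (coproj x) = B x.
Proof.
move=> hB hx; have [hpx _] := hP x.
have [h1 h2] := proj1 (ker_sqrt hB _) hpx.
have [h3 h4] := op_minus (sqrt_self_adjoint hB) hx h1; split => //.
rewrite h4 h2; vec.
Qed.

End Projection.

End SelfAdjoint.

(** * From Duhamel's formula to the weak form of the equation *)

Lemma constant_of_derive0 (f : R -> R) a b :
  (forall x, is_derive f x 0) -> f a = f b.
Proof.
move=> h; have [c [_ e]] := mean_value (f := f) (df := fun _ => 0) (a := a) (b := b) (fun x _ => h x).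
lra.
Qed.

Section Wave.

Variables (H : HilbertSpace) (A B : operator H) (S dS : R -> H -> H).
Hypotheses (sA : self_adjoint A) (hB : is_sqrt_operator A B)
  (hS : is_solution_operator A B S dS).

Let sB : self_adjoint B := sqrt_self_adjoint hB.
Let dB : dense_set (dom B) := proj1 (proj2 sB).

Lemma is_derive_reflect (f : R -> H) (l : H) (t r : R) :
  is_derive f (t - r) l -> is_derive (fun r => f (t - r)) r (opp l).
Proof.
move=> h; have h1 : is_derive (fun r : R => t - r) r (- (1)) by auto_derive; lra.
have := is_derive_comp f (fun r => t - r) r _ _ h h1.
by rewrite (scal_opp_one (l : H)).
Qed.

Lemma is_derive_shift (f : R -> H) (l : H) (s t : R) :
  is_derive f (t + s) l -> is_derive (fun r => f (r + s)) t l.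
Proof.
move=> h; have h1 : is_derive (fun r : R => r + s) t 1 by auto_derive; lra.
have := is_derive_comp f (fun r => r + s) t _ _ h h1.
by rewrite (scal_one (l : H)).
Qed.

Lemma S_dom (t : R) (v : H) : dom B v -> dom A (S t v).
Proof. by move=> hv; have [h _] := proj2 hS v hv; have [? _] := h t. Qed.

Lemma S_domB (t : R) (v : H) : dom B v -> dom B (S t v).
Proof. by move=> hv; have [h _] := sqrt_dom hB (S_dom t hv). Qed.

Lemma dS_dom (t : R) (v : H) : dom B v -> dom B (dS t v).
Proof. by move=> hv; have [h _] := proj2 hS v hv; have [_ [? _]] := h t. Qed.

Lemma S_derive (t : R) (v : H) : dom B v -> is_derive (fun r => S r v) t (dS t v).
Proof. by move=> hv; have [h _] := proj2 hS v hv; have [_ [_ [? _]]] := h t. Qed.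

Lemma dS_derive (t : R) (v : H) :
  dom B v -> is_derive (fun r => dS r v) t (opp (A (S t v))).
Proof. by move=> hv; have [h _] := proj2 hS v hv; have [_ [_ [_ [? _]]]] := h t. Qed.

Lemma BS_derive (t : R) (v : H) :
  dom B v -> is_derive (fun r => B (S r v)) t (B (dS t v)).
Proof. by move=> hv; have [h _] := proj2 hS v hv; have [_ [_ [_ [_ [? _]]]]] := h t. Qed.

Lemma AS_continuous (t : R) (v : H) :
  dom B v -> continuous (fun r => A (S r v)) t.
Proof. by move=> hv; have [h _] := proj2 hS v hv; have [_ [_ [_ [_ [_ [? _]]]]]] := h t. Qed.

Lemma S_0 (v : H) : dom B v -> S 0 v = zero.
Proof. by move=> hv; have [_ [h _]] := proj2 hS v hv. Qed.

Lemma dS_0 (v : H) : dom B v -> dS 0 v = v.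
Proof. by move=> hv; have [_ [_ h]] := proj2 hS v hv. Qed.

(** For two solutions of w'' + A w = 0 the Wronskian <w, v'> - <w', v> is constant.
    With w run backwards from time t its values at the two ends are the two sides
    of the identity. *)
Lemma S_sym (t : R) (a b : H) : dom B a -> dom B b ->
  inner (S t a) b = inner a (S t b).
Proof.
move=> ha hb.
pose g r := inner (S (t - r) a) (dS r b) + inner (dS (t - r) a) (S r b).
have : g 0 = g t.
  apply: constant_of_derive0 => r.
  have h1 := is_derive_inner (is_derive_reflect (S_derive (t - r) ha)) (dS_derive r hb).
  have h2 := is_derive_inner (is_derive_reflect (dS_derive (t - r) ha)) (S_derive r hb).
  have := is_derive_plus _ _ _ _ _ h1 h2.
  congr is_derive.
  inner_expand; rewrite /plus /= (self_adjoint_sym sA (S_dom _ ha) (S_dom _ hb)); ring.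
rewrite /g Rminus_0_r Rminus_diag !S_0 // !dS_0 //; inner_expand; lra.
Qed.

(** Here the conserved quantity is the polarized energy of a solution and of a
    time-reversed one. *)
Lemma dS_sym (t : R) (a b : H) : dom B a -> dom B b ->
  inner (dS t a) b = inner a (dS t b).
Proof.
move=> ha hb.
pose g r := inner (dS (t - r) a) (dS r b) - inner (B (S (t - r) a)) (B (S r b)).
have : g 0 = g t.
  apply: constant_of_derive0 => r.
  have h1 := is_derive_inner (is_derive_reflect (dS_derive (t - r) ha)) (dS_derive r hb).
  have h2 := is_derive_inner (is_derive_reflect (BS_derive (t - r) ha)) (BS_derive r hb).
  have := is_derive_minus _ _ _ _ _ h1 h2.
  congr is_derive.
  inner_expand; rewrite /minus /plus /opp /=.
  rewrite (inner_sqrt hB (S_dom _ ha) (dS_dom _ hb)).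
  rewrite (inner_sym (dS (t - r) a)) (inner_sqrt hB (S_dom _ hb) (dS_dom _ ha)).
  rewrite (inner_sym (B (S r b))); ring.
have [_ z] := op_zero sB.
rewrite /g Rminus_0_r Rminus_diag !S_0 // !dS_0 // z; inner_expand; lra.
Qed.

(** The time derivative of [dS_sym]. *)
Lemma AS_sym (t : R) (a b : H) : dom B a -> dom B b ->
  inner (A (S t a)) b = inner a (A (S t b)).
Proof.
move=> ha hb.
have h1 := is_derive_inner_const b (dS_derive t ha).
have h2 := is_derive_inner_const a (dS_derive t hb).
have h3 : is_derive (fun r => inner (dS r b) a) t (inner (opp (A (S t a))) b).
  by apply: (is_derive_ext _ _ _ _ _ h1) => r; rewrite dS_sym // inner_sym.
have := is_derive_unique _ _ _ h2; rewrite (is_derive_unique _ _ _ h3).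
inner_expand; rewrite (inner_sym a); lra.
Qed.

(** The time derivative of [AS_sym], with one power of B on each side because A S v
    need not be differentiable. *)
Lemma BdS_sym (t : R) (a b : H) : dom B a -> dom B b ->
  inner (B (dS t a)) (B b) = inner (B a) (B (dS t b)).
Proof.
move=> ha hb.
have h1 := is_derive_inner_const (B b) (BS_derive t ha).
have h2 := is_derive_inner_const (B a) (BS_derive t hb).
have h3 : is_derive (fun r => inner (B (S r b)) (B a)) t (inner (B (dS t a)) (B b)).
  apply: (is_derive_ext _ _ _ _ _ h1) => r.
  by rewrite -(inner_sqrt hB (S_dom _ ha) hb) AS_sym // inner_sym (inner_sqrt hB (S_dom _ hb) ha).
have := is_derive_unique _ _ _ h2; rewrite (is_derive_unique _ _ _ h3) => ->.
exact: inner_sym.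
Qed.

Lemma S_sym_all (t : R) (x b : H) : dom B b -> inner (S t x) b = inner x (S t b).
Proof.
move=> hb; apply: (linear_dense_adjoint dB (proj1 hS t)) => a ha.
exact: S_sym.
Qed.

Lemma S_A_sym (t : R) (x b : H) : dom A b -> inner (S t x) (A b) = inner x (A (S t b)).
Proof.
move=> hb; have [hb' _] := sqrt_dom hB hb.
apply: (linear_dense_adjoint dB (proj1 hS t)) => a ha.
by rewrite -AS_sym // (self_adjoint_sym sA (S_dom _ ha) hb).
Qed.

Lemma S_0_all (x : H) : S 0 x = zero.
Proof.
apply: (orth_dense dB) => b hb.
by rewrite S_sym_all // S_0 // inner_zero_r.
Qed.

(** The difference quotients of S at 0 regularize: they map D(B) into D(A)
    and converge to the identity in the graph norm of B. *)
Lemma core_approximation (v : H) : dom B v -> exists psi : R -> H,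
  (forall h, dom A (psi h)) /\
  filterlim psi (locally' 0) (locally v) /\
  filterlim (fun h => B (psi h)) (locally' 0) (locally (B v)).
Proof.
move=> hv; exists (fun h => scal (/ h) (S h v)); split; last split.
- by move=> h; have [] := op_scal (/ h) sA (S_dom h hv).
- have /is_derive_quotP := S_derive 0 hv; rewrite dS_0 //.
  apply: filterlim_ext => h; rewrite /diff_quot S_0 // Rminus_0_r.
  by rewrite minus_zero_r.
- have /is_derive_quotP := BS_derive 0 hv; rewrite dS_0 //.
  apply: filterlim_ext => h; rewrite /diff_quot S_0 // Rminus_0_r.
  have [_ ->] := op_scal (/ h) sB (S_domB h hv).
  by have [_ ->] := op_zero sB; rewrite minus_zero_r.
Qed.

Section Duhamel.

Variables (t0 : R) (u0 u1 : H) (f u : R -> H).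
Hypotheses (hu0 : dom B u0) (cf : forall r, continuous f r)
  (duhamel : forall t, t0 <= t ->
    let g := fun tau => S (t - tau) (f tau) in
    ex_RInt g t0 t /\
    u t = minus (plus (dS (t - t0) u0) (S (t - t0) u1)) (RInt g t0 t)).

Lemma duhamel_tested (t : R) (v : H) : dom B v -> t0 <= t ->
  inner (u t) v = inner u0 (dS (t - t0) v) + inner u1 (S (t - t0) v)
    - RInt (fun r => inner (f r) (S (t - r) v)) t0 t.
Proof.
move=> hv ht; have [[I hI] ->] := duhamel ht.
rewrite (is_RInt_unique _ _ _ _ hI); inner_expand.
rewrite dS_sym // S_sym_all //; congr (_ - _).
rewrite -(is_RInt_unique _ _ _ _ (is_RInt_inner (z := v) hI)).
by apply: RInt_ext => r _; rewrite S_sym_all.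
Qed.

(** The inner product with v of the derivative of Duhamel's formula, with the
    solution operator moved onto v. The first term is -<u0, A S(t - t0) v>,
    written so that it can be differentiated once more. *)
Definition tested_velocity (v : H) (t : R) : R :=
  - inner (B u0) (B (S (t - t0) v)) + inner u1 (dS (t - t0) v)
  - RInt (fun r => inner (f r) (dS (t - r) v)) t0 t.

Lemma is_derive_conv_S (v : H) (t : R) : dom B v ->
  is_derive (fun t => RInt (fun r => inner (f r) (S (t - r) v)) t0 t) t
    (RInt (fun r => inner (f r) (dS (t - r) v)) t0 t).
Proof.
move=> hv.
have := is_derive_convolution t0 t cf (fun r => S_derive r hv)
  (fun r => is_derive_continuous (dS_derive r hv)).
by rewrite S_0 // inner_zero_r Rplus_0_l.
Qed.

Lemma is_derive_conv_dS (v : H) (t : R) : dom B v ->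
  is_derive (fun t => RInt (fun r => inner (f r) (dS (t - r) v)) t0 t) t
    (inner (f t) v + RInt (fun r => inner (f r) (opp (A (S (t - r) v)))) t0 t).
Proof.
move=> hv.
have c r : continuous (fun r => opp (A (S r v))) r.
  by apply: continuous_opp; apply: AS_continuous.
have := is_derive_convolution t0 t cf (fun r => dS_derive r hv) c.
by rewrite dS_0.
Qed.

Lemma is_derive_shift_back (g : R -> H) (l : H) (s t : R) :
  is_derive g (t - s) l -> is_derive (fun r => g (r - s)) t l.
Proof. exact: is_derive_shift. Qed.

Lemma tested_velocityE (v : H) (t : R) (du : H) : dom B v -> t0 < t ->
  is_derive u t du -> inner du v = tested_velocity v t.
Proof.
move=> hv ht hd.
have h1 := is_derive_inner_const v hd.
rewrite -(is_derive_unique _ _ _ h1); apply: is_derive_unique.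
apply: (is_derive_ext_loc (fun t => inner (dS (t - t0) v) u0 + inner (S (t - t0) v) u1
    - RInt (fun r => inner (f r) (S (t - r) v)) t0 t)).
  have ht' : 0 < t - t0 by lra.
  exists (mkposreal _ ht') => r /=; rewrite /ball /= /AbsRing_ball /abs /minus /plus /opp /= => hr.
  rewrite duhamel_tested // ?(inner_sym u0) ?(inner_sym u1) //.
  by move: (Rabs_def2 _ _ hr); lra.
have h2 := is_derive_inner_const u0 (is_derive_shift_back (dS_derive (t - t0) hv)).
have h3 := is_derive_inner_const u1 (is_derive_shift_back (S_derive (t - t0) hv)).
have := is_derive_minus _ _ _ _ _ (is_derive_plus _ _ _ _ _ h2 h3) (is_derive_conv_S t hv).
congr is_derive.
rewrite /minus /plus /opp /= /tested_velocity inner_opp_l (inner_sqrt hB (S_dom _ hv) hu0).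
rewrite (inner_sym (B u0)) (inner_sym u1); ring.
Qed.

Lemma tested_velocity0 (v : H) : dom B v -> tested_velocity v t0 = inner u1 v.
Proof.
move=> hv; rewrite /tested_velocity Rminus_diag RInt_point S_0 // dS_0 //.
have [_ ->] := op_zero sB; rewrite inner_zero_r; change (zero : R) with 0; ring.
Qed.

Lemma is_derive_tested_velocity_raw (v : H) (t : R) : dom B v ->
  is_derive (tested_velocity v) t
   (- inner (B u0) (B (dS (t - t0) v)) - inner u1 (A (S (t - t0) v))
    - (inner (f t) v + RInt (fun r => inner (f r) (opp (A (S (t - r) v)))) t0 t)).
Proof.
move=> hv.
have h1 := is_derive_inner_const (B u0) (is_derive_shift_back (BS_derive (t - t0) hv)).
have h2 := is_derive_inner_const u1 (is_derive_shift_back (dS_derive (t - t0) hv)).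
have := is_derive_minus _ _ _ _ _ (is_derive_minus _ _ _ _ _ h2 h1) (is_derive_conv_dS t hv).
move=> h3.
apply: (is_derive_ext (fun t => minus (minus (inner (dS (t - t0) v) u1)
   (inner (B (S (t - t0) v)) (B u0))) (RInt (fun r => inner (f r) (dS (t - r) v)) t0 t))).
  move=> r; rewrite /tested_velocity (inner_sym u1) (inner_sym (B u0)) /minus /plus /opp /=; ring.
move: h3; congr is_derive.
rewrite /minus /plus /opp /= inner_opp_l (inner_sym u1) (inner_sym (B u0)); ring.
Qed.

(** The second derivative of Duhamel's formula reproduces the formula itself,
    tested with A v. *)
Lemma is_derive_tested_velocity (v : H) (t : R) : dom A v -> t0 <= t ->
  is_derive (tested_velocity v) t (- inner (u t) (A v) - inner (f t) v).
Proof.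
move=> hv ht; have [hv' _] := sqrt_dom hB hv.
have := is_derive_tested_velocity_raw t hv'; congr is_derive.
have [[I hI] ->] := duhamel ht.
rewrite (is_RInt_unique _ _ _ _ hI).
rewrite inner_minus_l inner_plus_l S_A_sym //.
rewrite (inner_sym (dS _ u0)) (inner_sqrt hB hv (dS_dom _ hu0)) (inner_sym (B v)) BdS_sym //.
have -> : RInt (fun r => inner (f r) (opp (A (S (t - r) v)))) t0 t = - inner I (A v).
  apply: is_RInt_unique; have := is_RInt_opp _ _ _ _ (is_RInt_inner (z := A v) hI).
  by apply: is_RInt_ext => r _; rewrite S_A_sym // inner_opp_r.
by move=> /=; ring.
Qed.

End Duhamel.

End Wave.

(** * Energy identities for weak solutions *)

Lemma is_derive_of_error (f : R -> R) (x l : R) :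
  (forall e, 0 < e -> locally x (fun y => Rabs (f y - f x - (y - x) * l) <= e * Rabs (y - x))) ->
  is_derive f x l.
Proof.
move=> h; split; first exact: (is_linear_scal_l (V := R_NormedModule)).
move=> x' hx' e; rewrite -(is_filter_lim_locally_unique x x' hx').
exact: (h e (cond_pos e)).
Qed.

Lemma filterlim_Rle {T : Type} {FT : (T -> Prop) -> Prop} {FF : ProperFilter FT}
    (f g : T -> R) (a b : R) :
  FT (fun x => f x <= g x) -> filterlim f FT (locally a) ->
  filterlim g FT (locally b) -> a <= b.
Proof. by move=> h hf hg; apply: (filterlim_le (F := FT) f g (Finite a) (Finite b) h hf hg). Qed.

Lemma filterlim_Rabs {T : Type} {FT : (T -> Prop) -> Prop} (f : T -> R) (a : R) :
  filterlim f FT (locally a) -> filterlim (fun x => Rabs (f x)) FT (locally (Rabs a)).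
Proof. exact: (filterlim_norm_fun (V := R_NormedModule)). Qed.

Lemma locally'_proper (x : R) : ProperFilter (locally' x).
Proof. exact: (Rbar_locally'_filter (Finite x)). Qed.

Lemma filterlim_shift_at_right (r : R) :
  filterlim (fun s => r + s) (at_right 0) (locally' r).
Proof.
move=> Q [e he]; exists e => s hs h0; apply: he; last by move=> ?; lra.
by move: hs; rewrite /ball /= /AbsRing_ball /abs /minus /plus /opp /=;
  have -> : r + s + - r = s + - 0 by ring.
Qed.

Section Weak.

Variables (H : HilbertSpace) (B : operator H).
Hypothesis sB : self_adjoint B.

(** Weak form, on the open half-line, of w'' + B^2 w + f = 0. *)
Definition weak_solution (t0 : R) (w dw f : R -> H) : Prop :=
  forall t, t0 < t ->
  dom B (w t) /\ is_derive w t (dw t) /\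
  continuous (fun r => B (w r)) t /\ continuous dw t /\ continuous f t /\
  forall v, dom B v ->
    is_derive (fun r => inner (dw r) v) t (- inner (B (w t)) (B v) - inner (f t) v).

Lemma near_ball (P : R -> Prop) (t : R) : locally t P ->
  exists d, 0 < d /\ forall r, Rabs (r - t) < d -> P r.
Proof. by move=> [d hd]; exists d; split => //; apply: cond_pos. Qed.

Lemma locally_near (P : R -> Prop) (t d : R) : 0 < d ->
  (forall r, Rabs (r - t) < d -> P r) -> locally t P.
Proof. by move=> hd h; exists (mkposreal d hd). Qed.

Lemma near_vector (g : R -> H) (t e : R) : 0 < e -> continuous g t ->
  locally t (fun r => norm (minus (g r) (g t)) < e).
Proof. by move=> he /filterlim_normP; apply. Qed.

Lemma between_near a b t d : Rabs (a - t) < d -> Rabs (b - t) < d ->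
  forall x, Rmin a b <= x <= Rmax a b -> Rabs (x - t) < d.
Proof.
move=> /Rabs_def2 ha /Rabs_def2 hb x; rewrite /Rmin /Rmax.
by case: Rle_dec => _ hx; apply: Rabs_def1; lra.
Qed.

(** A core for B suffices as a set of test vectors: the derivative of the tested
    velocity is controlled by mean values, a bound that passes to graph limits. *)
Lemma weak_solution_of_core (D : H -> Prop) (t0 : R) (w dw f : R -> H) :
  (forall v, dom B v -> exists psi : R -> H,
    (forall h, D (psi h)) /\ filterlim psi (locally' 0) (locally v) /\
    filterlim (fun h => B (psi h)) (locally' 0) (locally (B v))) ->
  (forall t, t0 < t ->
    dom B (w t) /\ is_derive w t (dw t) /\
    continuous (fun r => B (w r)) t /\ continuous dw t /\ continuous f t /\
    forall v, D v ->
      is_derive (fun r => inner (dw r) v) t (- inner (B (w t)) (B v) - inner (f t) v)) ->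
  weak_solution t0 w dw f.
Proof.
move=> core h t ht; have [h1 [h2 [h3 [h4 [h5 _]]]]] := h t ht.
do 5 split => //; move=> v hv; have [psi [hD [l1 l2]]] := core v hv.
apply: is_derive_of_error => e he.
pose k := norm (B v) + norm v + 1.
have hk : 0 < k.
  by have := norm_ge_0 (B v); have := norm_ge_0 (v : H); rewrite /k; lra.
have hk' := Rdiv_lt_0_compat _ _ he hk.
have [d [hd near]] := near_ball (filter_and _ _ (near_vector hk' h3) (near_vector hk' h5)).
have hd' : 0 < Rmin d (t - t0) by apply: Rmin_glb_lt; lra.
apply: (locally_near hd') => r hr.
have hr1 := Rlt_le_trans _ _ _ hr (Rmin_l _ _).
have hr2 := Rlt_le_trans _ _ _ hr (Rmin_r _ _).
have est (z : H) : D z ->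
    Rabs (inner (dw r) z - inner (dw t) z
          - (r - t) * (- inner (B (w t)) (B z) - inner (f t) z))
    <= e / k * (norm (B z) + norm z) * Rabs (r - t).
  move=> hz.
  have tin p : Rmin t r <= p <= Rmax t r -> Rabs (p - t) < d /\ Rabs (p - t) < t - t0.
    by move=> hp; split; apply: (between_near (a := t) (b := r)) => //;
       rewrite Rminus_diag Rabs_R0; lra.
  have [p [hp ep]] : exists p, Rmin t r <= p <= Rmax t r /\
      inner (dw r) z - inner (dw t) z = (- inner (B (w p)) (B z) - inner (f p) z) * (r - t).
    apply: (mean_value (f := fun r => inner (dw r) z)
      (df := fun p => - inner (B (w p)) (B z) - inner (f p) z)) => p hp.
    have [_ /Rabs_def2 hp2] := tin p hp.
    have ht' : t0 < p by lra.
    by have [_ [_ [_ [_ [_ hz']]]]] := h p ht'; apply: hz'.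
  have [hp1 _] := tin p hp.
  have n1 : norm (minus (B (w p)) (B (w t))) < e / k by have [] := near p hp1.
  have n2 : norm (minus (f p) (f t)) < e / k by have [] := near p hp1.
  have -> : inner (dw r) z - inner (dw t) z
          - (r - t) * (- inner (B (w t)) (B z) - inner (f t) z)
      = (r - t) * - (inner (minus (B (w p)) (B (w t))) (B z) + inner (minus (f p) (f t)) z).
    rewrite ep; inner_expand; ring.
  rewrite Rabs_mult Rabs_Ropp Rmult_comm.
  apply: Rmult_le_compat_r; first exact: Rabs_pos.
  apply: Rle_trans; first exact: Rabs_triang.
  have c1 := cauchy_schwarz (minus (B (w p)) (B (w t))) (B z).
  have c2 := cauchy_schwarz (minus (f p) (f t)) z.
  have m1 := Rmult_le_compat_r _ _ _ (norm_ge_0 (B z)) (Rlt_le _ _ n1).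
  have m2 := Rmult_le_compat_r _ _ _ (norm_ge_0 (z : H)) (Rlt_le _ _ n2).
  lra.
have lim1 (x : H) : filterlim (fun h => inner x (psi h)) (locally' 0) (locally (inner x v)).
  by apply: filterlim_inner => //; apply: filterlim_const.
have lim2 (x : H) : filterlim (fun h => inner x (B (psi h))) (locally' 0) (locally (inner x (B v))).
  by apply: filterlim_inner => //; apply: filterlim_const.
have : Rabs (inner (dw r) v - inner (dw t) v
          - (r - t) * (- inner (B (w t)) (B v) - inner (f t) v))
    <= e / k * (norm (B v) + norm v) * Rabs (r - t).
  apply: (filterlim_Rle (FF := locally'_proper 0) (filter_forall _ (fun h => est _ (hD h)))).
    apply: filterlim_Rabs; apply: filterlim_Rminus; first exact: filterlim_Rminus.
    apply: filterlim_Rmult; first exact: filterlim_const.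
    apply: filterlim_Rminus => //.
    have := lim2 (opp (B (w t))); rewrite inner_opp_l.
    by apply: filterlim_ext => x; rewrite inner_opp_l.
  apply: filterlim_Rmult; last exact: filterlim_const.
  apply: filterlim_Rmult; first exact: filterlim_const.
  by apply: filterlim_Rplus; apply: filterlim_norm_fun.
have : e / k * (norm (B v) + norm v) <= e.
  have ek : e / k * k = e by field; lra.
  rewrite -{2}ek; apply: Rmult_le_compat_l; first lra.
  by rewrite /k; lra.
by have := Rabs_pos (r - t); nra.
Qed.

Lemma antiderivative (g : R -> H) (t0 : R) : (forall r, t0 < r -> continuous g r) ->
  exists G : R -> H, forall r, t0 < r -> is_derive G r (g r).
Proof.
move=> cg; exists (fun r => RInt g (t0 + 1) r) => r hr.
have hr' : 0 < r - t0 by lra.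
apply: (is_derive_RInt g _ (t0 + 1)); last exact: cg.
apply: (locally_near hr') => p /Rabs_def2 hp.
apply: RInt_correct; apply: ex_RInt_continuous => z hz; apply: cg.
have : t0 < Rmin (t0 + 1) p by apply: Rmin_glb_lt; lra.
lra.
Qed.

Lemma is_derive_scal_vec (k : R) (g : R -> H) (t : R) (l : H) :
  is_derive g t l -> is_derive (fun r => scal k (g r)) t (scal k l).
Proof.
move=> /is_derive_quotP h; apply/is_derive_quotP.
apply: (filterlim_ext (fun r => scal k (diff_quot g t r))).
  by move=> r; rewrite /diff_quot; vec.
by apply: filterlim_scal_fun => //; apply: filterlim_const.
Qed.

Definition forward_average (G : R -> H) (s r : R) : H := scal (/ s) (minus (G (r + s)) (G r)).

Lemma is_derive_forward_average (G g : R -> H) (s r : R) :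
  is_derive G r (g r) -> is_derive G (r + s) (g (r + s)) ->
  is_derive (forward_average G s) r (forward_average g s r).
Proof.
move=> h1 h2; apply: is_derive_scal_vec.
by have := is_derive_minus _ _ _ _ _ (is_derive_shift h2) h1.
Qed.

Lemma forward_average_lim (G : R -> H) (l : H) (r : R) :
  is_derive G r l ->
  filterlim (fun s => forward_average G s r) (at_right 0) (locally l).
Proof.
move=> /is_derive_quotP h.
have := filterlim_comp _ _ _ _ _ _ _ _ (filterlim_shift_at_right (r := r)) h.
apply: filterlim_ext => s; rewrite /diff_quot /forward_average.
by have -> : r + s - r = s by ring.
Qed.

Lemma forward_average_near (G g : R -> H) (c : H) (s r e : R) : 0 < s -> 0 <= e ->
  (forall x, r <= x <= r + s -> is_derive G x (g x)) ->
  (forall x, r <= x <= r + s -> norm (minus (g x) c) <= e) ->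
  norm (minus (forward_average G s r) c) <= e.
Proof.
move=> hs he hd hb; have hrs : r < r + s by lra.
have := mean_value_bound hrs he hd hb.
by have -> : r + s - r = s by ring.
Qed.

Lemma inner_near (a b c d : H) (e : R) : 0 <= e <= 1 ->
  norm (minus a c) <= e -> norm (minus b d) <= e ->
  Rabs (inner a b - inner c d) <= e * (norm c + norm d + 1).
Proof.
move=> he h1 h2.
have -> : inner a b - inner c d = inner (minus a c) (minus b d)
    + inner (minus a c) d + inner c (minus b d) by inner_expand; ring.
have c1 := cauchy_schwarz (minus a c) (minus b d).
have c2 := cauchy_schwarz (minus a c) d.
have c3 := cauchy_schwarz c (minus b d).
have t1 := Rabs_triang (inner (minus a c) (minus b d) + inner (minus a c) d) (inner c (minus b d)).
have t2 := Rabs_triang (inner (minus a c) (minus b d)) (inner (minus a c) d).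
have p1 := norm_ge_0 (minus a c); have p2 := norm_ge_0 (minus b d).
have p3 := norm_ge_0 (c : H); have p4 := norm_ge_0 (d : H); nra.
Qed.

(** The velocity is not an admissible test vector, but its average over [r, r + s]
    is the difference quotient of w, which lies in the domain of B. The averages
    of w', B w and f satisfy the energy identity exactly, and its integrated form
    passes to the limit as s tends to 0 because w', B w and f are continuous. *)
Lemma energy_derivative (t0 : R) (w dw f : R -> H) (t : R) :
  weak_solution t0 w dw f -> t0 < t ->
  is_derive (fun r => / 2 * norm (dw r) ^ 2 + / 2 * norm (B (w r)) ^ 2) t
    (- inner (f t) (dw t)).
Proof.
move=> hw ht.
have [Z dZ] := antiderivative (fun r hr => proj1 (proj2 (proj2 (hw r hr)))).
have [G dG] := antiderivative (fun r hr => proj1 (proj2 (proj2 (proj2 (proj2 (hw r hr)))))).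
pose W := forward_average w; pose ZZ := forward_average Z; pose GG := forward_average G.
pose en s r := / 2 * norm (W s r) ^ 2 + / 2 * norm (ZZ s r) ^ 2.
have weak a b v : t0 < a -> t0 < b -> dom B v ->
    inner (minus (dw b) (dw a)) v
    = - inner (minus (Z b) (Z a)) (B v) - inner (minus (G b) (G a)) v.
  move=> ha hb hv.
  have [c [_ ec]] : exists c, Rmin a b <= c <= Rmax a b /\
      (inner (dw b) v + inner (Z b) (B v) + inner (G b) v)
      - (inner (dw a) v + inner (Z a) (B v) + inner (G a) v) = 0 * (b - a).
    apply: (mean_value (f := fun r => inner (dw r) v + inner (Z r) (B v) + inner (G r) v)
      (df := fun _ => 0)) => x hx.
    have hx0 : t0 < x by have hm := Rmin_glb_lt _ _ _ ha hb; lra.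
    have [_ [_ [_ [_ [_ h]]]]] := hw x hx0.
    have := is_derive_plus _ _ _ _ _ (is_derive_plus _ _ _ _ _ (h v hv)
      (is_derive_inner_const (B v) (dZ x hx0))) (is_derive_inner_const v (dG x hx0)).
    by congr is_derive; rewrite /plus /=; ring.
  inner_expand; lra.
(* the averaged velocity takes its values in the domain of B, so that it is an
   admissible test vector *)
have den s r : 0 < s -> t0 < r -> is_derive (en s) r (- inner (GG s r) (W s r)).
  move=> hs hr; have hrs : t0 < r + s by lra.
  have [w1 [w2 _]] := hw r hr; have [w3 [w4 _]] := hw (r + s) hrs.
  have [o1 o2] := op_minus sB w3 w1; have [o3 o4] := op_scal (/ s) sB o1.
  have d1 := is_derive_forward_average (g := dw) w2 w4.
  have d2 := is_derive_forward_average (g := fun r => B (w r)) (dZ r hr) (dZ _ hrs).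
  have := is_derive_plus _ _ _ _ _
    (is_derive_scal _ _ (/ 2) _ (is_derive_norm_sq d1))
    (is_derive_scal _ _ (/ 2) _ (is_derive_norm_sq d2)).
  congr is_derive.
  have e1 : inner (forward_average dw s r) (W s r) =
      - inner (ZZ s r) (B (W s r)) - inner (GG s r) (W s r).
    by rewrite /forward_average inner_scal_l weak // /ZZ /GG /forward_average !inner_scal_l; ring.
  have e2 : forward_average (fun r => B (w r)) s r = B (W s r).
    by rewrite /W /forward_average o4 o2.
  change (plus ?a ?b) with (a + b).
  rewrite -/(W s r) e1 e2 (inner_sym (B (W s r))); rewrite -/(ZZ s r) /=; field.
apply: is_derive_of_error => e he.
have [_ [_ [_ [c1 [c2 _]]]]] := hw t ht.
pose k := norm (f t) + norm (dw t) + 1.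
have hk : 0 < k.
  by have := norm_ge_0 (f t); have := norm_ge_0 (dw t); rewrite /k; lra.
pose e1 := Rmin 1 (e / k).
have he1 : 0 < e1 by apply: Rmin_glb_lt; [lra | apply: Rdiv_lt_0_compat].
have [d [hd near]] := near_ball (filter_and _ _ (near_vector he1 c1) (near_vector he1 c2)).
have hd' : 0 < Rmin (d / 2) (t - t0) by apply: Rmin_glb_lt; lra.
apply: (locally_near hd') => r hr.
have hr1 := Rlt_le_trans _ _ _ hr (Rmin_l _ _).
have hr2 := Rlt_le_trans _ _ _ hr (Rmin_r _ _).
have tin p : Rmin t r <= p <= Rmax t r -> Rabs (p - t) < d / 2 /\ t0 < p.
  move=> hp; split.
    by apply: (between_near (a := t) (b := r)) => //; rewrite Rminus_diag Rabs_R0; lra.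
  suff /Rabs_def2 : Rabs (p - t) < t - t0 by lra.
  by apply: (between_near (a := t) (b := r)) => //; rewrite Rminus_diag Rabs_R0; lra.
have est s : 0 < s < d / 2 ->
    Rabs (en s r - en s t - (r - t) * - inner (f t) (dw t)) <= e * Rabs (r - t).
  move=> hs.
  have [p [hp ep]] : exists p, Rmin t r <= p <= Rmax t r /\
      en s r - en s t = - inner (GG s p) (W s p) * (r - t).
    apply: mean_value => p hp; have [_ hp0] := tin p hp; apply: den => //; lra.
  have [/Rabs_def2 hp1 hp0] := tin p hp.
  rewrite ep; have -> : - inner (GG s p) (W s p) * (r - t) - (r - t) * - inner (f t) (dw t)
     = - (inner (GG s p) (W s p) - inner (f t) (dw t)) * (r - t) by ring.
  rewrite Rabs_mult Rabs_Ropp; apply: Rmult_le_compat_r; first exact: Rabs_pos.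
  have n1 : norm (minus (GG s p) (f t)) <= e1.
    apply: (forward_average_near (g := f)); try lra.
      by move=> x hx; apply: dG; lra.
    by move=> x hx; left; apply: (proj2 (near x _)); apply: Rabs_def1; lra.
  have n2 : norm (minus (W s p) (dw t)) <= e1.
    apply: (forward_average_near (g := dw)); try lra.
      move=> x hx; have hx0 : t0 < x by lra.
      by have [_ [h _]] := hw x hx0.
    by move=> x hx; left; apply: (proj1 (near x _)); apply: Rabs_def1; lra.
  have he1' : 0 <= e1 <= 1 by have := Rmin_l 1 (e / k); rewrite -/e1; lra.
  apply: (Rle_trans _ _ _ (inner_near he1' n1 n2)).
  apply: (Rle_trans _ (e / k * k)); last by right; field; lra.
  by apply: Rmult_le_compat_r; [rewrite -/k; lra | apply: Rmin_r].
have lim q : t0 < q -> filterlim (fun s => en s q) (at_right 0)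
    (locally (/ 2 * norm (dw q) ^ 2 + / 2 * norm (B (w q)) ^ 2)).
  move=> hq; have [_ [h _]] := hw q hq.
  have l1 := filterlim_norm_fun (forward_average_lim h).
  have l2 := filterlim_norm_fun (forward_average_lim (dZ q hq)).
  apply: filterlim_Rplus; (apply: filterlim_Rmult; first exact: filterlim_const);
    rewrite /= ; apply: filterlim_Rmult => //; apply: filterlim_Rmult => //; exact: filterlim_const.
apply: (filterlim_Rle (FT := at_right 0)
  (f := fun s => Rabs (en s r - en s t - (r - t) * - inner (f t) (dw t)))
  (g := fun _ => e * Rabs (r - t))).
- have hd2 : 0 < d / 2 by lra.
  exists (mkposreal _ hd2) => s hs hs0; apply: est; split => //.
  by move: hs; rewrite /ball /= /AbsRing_ball /abs /minus /plus /opp /= => /Rabs_def2; lra.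
- apply: filterlim_Rabs; apply: filterlim_Rminus; last exact: filterlim_const.
  by apply: filterlim_Rminus; apply: lim => //; move: (Rabs_def2 _ _ hr2); lra.
- exact: filterlim_const.
Qed.

(** Unlike the energy, this only needs the equation tested with the fixed
    vector w t. *)
Lemma position_velocity_derivative (t0 : R) (w dw f : R -> H) (t : R) :
  weak_solution t0 w dw f -> t0 < t ->
  is_derive (fun r => inner (w r) (dw r)) t
    (norm (dw t) ^ 2 - norm (B (w t)) ^ 2 - inner (f t) (w t)).
Proof.
move=> hw ht; have [h1 [h2 [h3 [h4 [h5 h6]]]]] := hw t ht.
have /is_derive_quotP hq := h6 _ h1.
apply/is_derive_quotP.
apply: (filterlim_ext_loc (fun r => inner (diff_quot w t r) (dw r)
     + diff_quot (fun r => inner (dw r) (w t)) t r)).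
  rewrite /locally' /within; apply: filter_forall => r hr.
  rewrite /diff_quot; inner_expand; change (scal ?a ?b) with (a * b).
  change (@minus R_AbelianGroup) with Rminus; rewrite /minus /plus /opp /=.
  rewrite (inner_sym (w t)) (inner_sym (w t)); ring.
have -> : norm (dw t) ^ 2 - norm (B (w t)) ^ 2 - inner (f t) (w t)
   = inner (dw t) (dw t) + (- inner (B (w t)) (B (w t)) - inner (f t) (w t)).
  by rewrite !inner_norm; ring.
apply: filterlim_Rplus => //; apply: filterlim_inner; first exact/is_derive_quotP.
exact: continuous_punctured.
Qed.

(** The projection is symmetric and does not change B, so it can be moved onto the
    test vector. *)
Lemma weak_solution_coproj (A : operator H) (P : H -> H) (t0 : R) (w dw f : R -> H) :
  is_sqrt_operator A B -> is_orth_projection (ker A) P ->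
  weak_solution t0 w dw f ->
  weak_solution t0 (fun t => coproj P (w t)) (fun t => coproj P (dw t))
    (fun t => coproj P (f t)).
Proof.
move=> hB hP hw t ht; have [h1 [h2 [h3 [h4 [h5 h6]]]]] := hw t ht.
have [q1 q2] := coproj_sqrt hP hB h1.
have ht' : 0 < t - t0 by lra.
split; [|split; [|split; [|split; [|split]]]] => //.
- exact: (is_derive_coproj hP).
- apply: (continuous_ext_loc _ (fun r => B (w r))) => //.
  apply: (locally_near ht') => r /Rabs_def2 hr; have hr0 : t0 < r by lra.
  by have [hr1 _] := hw r hr0; have [_ ->] := coproj_sqrt hP hB hr1.
- exact: (filterlim_coproj hP).
- exact: (filterlim_coproj hP).
- move=> v hv; have [v1 v2] := coproj_sqrt hP hB hv.
  rewrite q2 -v2 (coproj_sym hP).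
  apply: (is_derive_ext (fun r => inner (dw r) (coproj P v))); last exact: h6.
  by move=> r; rewrite (coproj_sym hP).
Qed.

End Weak.

(** * The potential along a curve *)

Section Potential.

Variables (H : HilbertSpace) (B : operator H) (F : H -> R) (gradF : H -> H) (L0 : R -> R -> R).
Hypotheses (sB : self_adjoint B) (F_grad : has_gradient B F gradF)
  (L0_bounded : forall r, exists M, forall a b,
     0 <= a <= r -> 0 <= b <= r -> L0 a b <= M)
  (F_lip : forall v w, dom B v -> dom B w ->
     norm (minus (gradF v) (gradF w))
       <= L0 (norm1 B v) (norm1 B w) * norm1 B (minus v w)).

Lemma norm1_ge0 (x : H) : 0 <= norm1 B x.
Proof. exact: sqrt_pos. Qed.

Lemma norm_le_norm1 (x : H) : norm x <= norm1 B x.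
Proof.
rewrite -(sqrt_pow2 (norm x)); last exact: norm_ge_0.
by apply: sqrt_le_1_alt; have := pow2_ge_0 (norm (B x)); lra.
Qed.

Lemma norm_op_le_norm1 (x : H) : norm (B x) <= norm1 B x.
Proof.
rewrite -(sqrt_pow2 (norm (B x))); last exact: norm_ge_0.
by apply: sqrt_le_1_alt; have := pow2_ge_0 (norm x); lra.
Qed.

Lemma norm1_le (x : H) : norm1 B x <= norm x + norm (B x).
Proof.
have h1 := norm_ge_0 (x : H); have h2 := norm_ge_0 (B x).
rewrite -(sqrt_pow2 (norm x + norm (B x))); last lra.
by apply: sqrt_le_1_alt; nra.
Qed.

Lemma norm1_scal (k : R) (x : H) : dom B x -> norm1 B (scal k x) = Rabs k * norm1 B x.
Proof.
move=> hx; rewrite /norm1; have [_ ->] := op_scal k sB hx; rewrite !norm_scal_eq.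
rewrite -(sqrt_pow2 (Rabs k)) -?sqrt_mult_alt; try exact: Rabs_pos; last exact: pow2_ge_0.
by congr sqrt; rewrite sqrt_pow2; [ring | apply: Rabs_pos].
Qed.

Lemma norm_le_minus (x y : H) : norm x <= norm y + norm (minus x y).
Proof.
have {1}-> : x = plus y (minus x y) by vec.
exact: norm_triangle.
Qed.

(** Uniformity over the segment from x to z matters in the mean value argument
    for the potential, hence a constant that depends on x only. *)
Lemma gradient_lipschitz_near (x : H) : dom B x -> exists L, 0 <= L /\
  forall z, dom B z -> norm1 B (minus z x) <= 1 ->
    norm (minus (gradF z) (gradF x)) <= L * norm1 B (minus z x).
Proof.
move=> hx; have [M hM] := L0_bounded (norm x + norm (B x) + 2).
exists (Rmax 0 M); split; first exact: Rmax_l.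
move=> z hz hzx; apply: Rle_trans; first exact: F_lip.
apply: Rmult_le_compat_r; first exact: norm1_ge0.
apply: (Rle_trans _ M); last exact: Rmax_r.
have [_ e] := op_minus sB hz hx.
have h1 := norm_le_norm1 (minus z x); have h2 := norm_op_le_norm1 (minus z x).
rewrite e in h2; have h3 := norm_le_minus z x; have h4 := norm_le_minus (B z) (B x).
have h5 := norm1_le z; have h6 := norm1_le x.
have h7 := norm_ge_0 (x : H); have h8 := norm_ge_0 (B x).
by apply: hM; split; try exact: norm1_ge0; lra.
Qed.

Lemma potential_mean_value (x h : H) : dom B x -> dom B h ->
  exists c, 0 <= c <= 1 /\ F (plus x h) - F x = inner (gradF (plus x (scal c h))) h.
Proof.
move=> hx hh.
have dseg c : dom B (plus x (scal c h)).
  by have [h1 _] := op_scal c sB hh; have [] := op_plus sB hx h1.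
have [c [hc e]] : exists c, Rmin 0 1 <= c <= Rmax 0 1 /\
   F (plus x (scal 1 h)) - F (plus x (scal 0 h)) = inner (gradF (plus x (scal c h))) h * (1 - 0).
  apply: (mean_value (f := fun c => F (plus x (scal c h)))
    (df := fun c => inner (gradF (plus x (scal c h))) h)) => c _.
  apply: is_derive_of_error => e he.
  have hn := norm1_ge0 h.
  have he' : 0 < e / (norm1 B h + 1) by apply: Rdiv_lt_0_compat; lra.
  have [d [hd hF]] := F_grad (dseg c) he'.
  have hd' : 0 < d / (norm1 B h + 1) by apply: Rdiv_lt_0_compat; lra.
  apply: (locally_near hd') => r hr.
  have hrd : norm1 B (scal (r - c) h) <= d.
    rewrite norm1_scal //.
    have : Rabs (r - c) * (norm1 B h + 1) <= d / (norm1 B h + 1) * (norm1 B h + 1).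
      by apply: Rmult_le_compat_r; lra.
    have -> : d / (norm1 B h + 1) * (norm1 B h + 1) = d by field; lra.
    have := Rabs_pos (r - c); nra.
  have hrc := proj1 (op_scal (r - c) sB hh).
  have := hF _ hrc hrd.
  have -> : plus (plus x (scal c h)) (scal (r - c) h) = plus x (scal r h) by vec.
  rewrite norm1_scal // inner_scal_r => hb; apply: Rle_trans; first exact: hb.
  have -> : e / (norm1 B h + 1) * (Rabs (r - c) * norm1 B h)
     = e * Rabs (r - c) * (norm1 B h / (norm1 B h + 1)) by field; lra.
  rewrite -{2}(Rmult_1_r (e * Rabs (r - c))); apply: Rmult_le_compat_l.
    by apply: Rmult_le_pos; [lra | apply: Rabs_pos].
  apply: (Rmult_le_reg_r (norm1 B h + 1)); first lra.
  have -> : norm1 B h / (norm1 B h + 1) * (norm1 B h + 1) = norm1 B h by field; lra.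
  lra.
exists c; rewrite Rmin_left in hc; last lra; rewrite Rmax_right in hc; last lra.
split => //; move: e.
have -> : plus x (scal 1 h) = plus x h by vec.
have -> : plus x (scal 0 h) = x by vec.
move=> ->; ring.
Qed.

Section Filter.

Context {T : Type} {FT : (T -> Prop) -> Prop} {FF : Filter FT}.
Variables (v : T -> H) (x : H).
Hypotheses (dx : dom B x) (dv : FT (fun r => dom B (v r)))
  (lv : filterlim (fun r => norm1 B (minus (v r) x)) FT (locally 0)).

Lemma norm1_near : FT (fun r => dom B (v r) /\ norm1 B (minus (v r) x) <= 1).
Proof.
move/filterlim_RP: lv => /(_ 1 Rlt_0_1) h.
apply: (filter_imp _ _ _ (filter_and _ _ dv h)) => r [h1 h2]; split => //.
by move: h2; rewrite Rminus_0_r; have := Rle_abs (norm1 B (minus (v r) x)); lra.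
Qed.

Lemma filterlim_graph : filterlim v FT (locally x).
Proof.
apply: filterlim_norm_minus; apply: (filterlim_squeeze0 _ lv); apply: filter_forall => r.
by rewrite Rabs_pos_eq; [apply: norm_le_norm1 | apply: norm_ge_0].
Qed.

Lemma filterlim_op_graph : filterlim (fun r => B (v r)) FT (locally (B x)).
Proof.
apply: filterlim_norm_minus; apply: (filterlim_squeeze0 _ lv).
apply: (filter_imp _ _ _ dv) => r hr.
rewrite Rabs_pos_eq; last exact: norm_ge_0.
by have [_ <-] := op_minus sB hr dx; apply: norm_op_le_norm1.
Qed.

Lemma filterlim_gradient : filterlim (fun r => gradF (v r)) FT (locally (gradF x)).
Proof.
have [L [hL0 hL]] := gradient_lipschitz_near dx.
apply: filterlim_norm_minus.
apply: (filterlim_squeeze0 (g := fun r => L * norm1 B (minus (v r) x))).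
  apply: (filter_imp _ _ _ norm1_near) => r [h1 h2].
  by rewrite Rabs_pos_eq; [apply: hL | apply: norm_ge_0].
rewrite -(Rmult_0_r L); apply: filterlim_Rmult => //; exact: filterlim_const.
Qed.

Lemma potential_increment : exists L, 0 <= L /\
  FT (fun r => exists g, F (v r) - F x = inner g (minus (v r) x) /\
        norm (minus g (gradF x)) <= L * norm1 B (minus (v r) x)).
Proof.
have [L [hL0 hL]] := gradient_lipschitz_near dx; exists L; split => //.
apply: (filter_imp _ _ _ norm1_near) => r [h1 h2].
have [hm _] := op_minus sB h1 dx.
have [c [hc e]] := potential_mean_value dx hm.
exists (gradF (plus x (scal c (minus (v r) x)))); split.
  by rewrite -e; congr (F _ - F x); vec.
have [hs _] := op_scal c sB hm; have [hp _] := op_plus sB dx hs.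
have e1 : minus (plus x (scal c (minus (v r) x))) x = scal c (minus (v r) x) by vec.
have hn := norm1_ge0 (minus (v r) x).
have hle : norm1 B (scal c (minus (v r) x)) <= norm1 B (minus (v r) x).
  by rewrite norm1_scal // Rabs_pos_eq; nra.
apply: (Rle_trans _ (L * norm1 B (scal c (minus (v r) x)))).
  by rewrite -{2}e1; apply: hL => //; rewrite e1; lra.
exact: Rmult_le_compat_l.
Qed.

Lemma filterlim_potential : filterlim (fun r => F (v r)) FT (locally (F x)).
Proof.
have [L [hL0 hL]] := potential_increment.
have h : filterlim (fun r => F (v r) - F x) FT (locally 0).
  apply: (filterlim_squeeze0 (g := fun r => (L * norm1 B (minus (v r) x) + norm (gradF x))
     * norm1 B (minus (v r) x))).
    apply: (filter_imp _ _ _ hL) => r [g [-> hg]].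
    apply: Rle_trans; first exact: cauchy_schwarz.
    have h1 := norm_le_norm1 (minus (v r) x); have h2 := norm_le_minus g (gradF x).
    by apply: Rmult_le_compat; try exact: norm_ge_0; lra.
  have -> : 0 = (L * 0 + norm (gradF x)) * 0 by ring.
  apply: filterlim_Rmult => //; apply: filterlim_Rplus; last exact: filterlim_const.
  by apply: filterlim_Rmult => //; apply: filterlim_const.
have h1 : filterlim (fun r => F (v r) - F x + F x) FT (locally (0 + F x)).
  by apply: filterlim_Rplus => //; apply: filterlim_const.
rewrite Rplus_0_l in h1.
by apply: (filterlim_ext _ _ _ h1) => r; ring.
Qed.

End Filter.

(** The curve is differentiable in H only, but continuous in the graph norm;
    since the gradient takes its values in H this is enough. *)
Lemma potential_chain_rule (v : R -> H) (t : R) (dv : H) :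
  locally t (fun r => dom B (v r)) ->
  filterlim (fun r => norm1 B (minus (v r) (v t))) (locally t) (locally 0) ->
  is_derive v t dv ->
  is_derive (fun r => F (v r)) t (inner (gradF (v t)) dv).
Proof.
move=> hdom hlim hd.
have dt : dom B (v t) by apply: locally_singleton hdom.
have /is_derive_quotP hq := hd.
have [L [hL0 hL]] := potential_increment dt hdom hlim.
apply/is_derive_quotP.
have lw : filterlim (fun r => norm1 B (minus (v r) (v t))) (locally' t) (locally 0).
  by apply: (filterlim_filter_le_1 _ _ hlim); apply: filter_le_within.
have h0 : filterlim (fun r => diff_quot (fun r => F (v r)) t r
     - inner (gradF (v t)) (diff_quot v t r)) (locally' t) (locally 0).
  apply: (filterlim_squeeze0 (g := fun r => L * norm1 B (minus (v r) (v t)) * norm (diff_quot v t r))).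
    apply: (filter_imp _ _ _ (filter_le_within _ _ hL)) => r [g [e hg]].
    have -> : diff_quot (fun r => F (v r)) t r - inner (gradF (v t)) (diff_quot v t r)
       = inner (minus g (gradF (v t))) (diff_quot v t r).
      rewrite inner_minus_l /diff_quot !inner_scal_r -e; exact: eq_refl.
    apply: Rle_trans; first exact: cauchy_schwarz.
    by apply: Rmult_le_compat_r => //; apply: norm_ge_0.
  have -> : 0 = L * 0 * norm dv by ring.
  apply: filterlim_Rmult; last exact: filterlim_norm_fun.
  by apply: filterlim_Rmult => //; apply: filterlim_const.
have l1 : filterlim (fun r => inner (gradF (v t)) (diff_quot v t r)) (locally' t)
    (locally (inner (gradF (v t)) dv)).
  by apply: filterlim_inner => //; apply: filterlim_const.
have h2 := filterlim_Rplus (FF := @filter_filter _ _ (locally'_proper t)) h0 l1.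
rewrite Rplus_0_l in h2.
by apply: (filterlim_ext _ _ _ h2) => r; rewrite /Rminus Rplus_assoc Rplus_opp_l Rplus_0_r.
Qed.

End Potential.

(** * Mild solutions are weak solutions *)

Section Mild.

Variables (H : HilbertSpace) (A B : operator H) (S dS : R -> H -> H)
  (F : H -> R) (gradF : H -> H) (L0 : R -> R -> R) (alpha t0 : R) (u0 u1 : H) (u du : R -> H).
Hypotheses (sA : self_adjoint A) (hB : is_sqrt_operator A B)
  (hS : is_solution_operator A B S dS)
  (F_grad : has_gradient B F gradF)
  (L0_bounded : forall r, exists M, forall a b,
     0 <= a <= r -> 0 <= b <= r -> L0 a b <= M)
  (F_lip : forall v w, dom B v -> dom B w ->
     norm (minus (gradF v) (gradF w))
       <= L0 (norm1 B v) (norm1 B w) * norm1 B (minus v w))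
  (t0_gt0 : 0 < t0) (hu0 : dom B u0)
  (mild : is_mild_solution B S dS gradF (fun t => alpha / t) t0 u0 u1 u du).

Let sB : self_adjoint B := sqrt_self_adjoint hB.

Definition forcing (t : R) : H := plus (scal (alpha / t) (du t)) (gradF (u t)).

(** Continuity of [clamp g] on the whole line is continuity of g on the closed
    half-line, one-sided at t0; it lets the endpoint be treated like any other
    time. *)
Definition clamp {V : Type} (g : R -> V) (r : R) : V := g (Rmax t0 r).

Lemma clampE {V : Type} (g : R -> V) (r : R) : t0 <= r -> clamp g r = g r.
Proof. by move=> hr; rewrite /clamp Rmax_right. Qed.

Lemma clamp_continuous {V : UniformSpace} (g : R -> V) (r : R) :
  filterlim g (half_line_nbhs t0 (Rmax t0 r)) (locally (g (Rmax t0 r))) ->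
  continuous (clamp g) r.
Proof.
move=> h; apply: (filterlim_comp _ _ _ (Rmax t0) g _ _ _ _ h).
move=> Q [e he]; exists e => y hy; apply: he; last exact: Rmax_l.
move: hy; rewrite /ball /= /AbsRing_ball /abs /minus /plus /opp /= => /Rabs_def2 hy.
by apply: Rabs_def1; rewrite /Rmax; do 2 case: Rle_dec => ?; lra.
Qed.

Lemma half_line_filter (t : R) : Filter (half_line_nbhs t0 t).
Proof. by apply: within_filter; apply: locally_filter. Qed.

Lemma half_line_dom (t : R) : half_line_nbhs t0 t (fun r => dom B (u r)).
Proof.
rewrite /half_line_nbhs /within; apply: filter_forall => r hr.
exact: (proj1 (mild hr)).
Qed.

Lemma mild_dom (t : R) : t0 <= t -> dom B (u t).
Proof. by move=> ht; exact: (proj1 (mild ht)). Qed.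

Let hl t : Filter (half_line_nbhs t0 t) := half_line_filter t.

Lemma clamp_position_continuous (r : R) : continuous (clamp u) r.
Proof.
apply: clamp_continuous; have [h1 [h2 _]] := mild (Rmax_l t0 r).
exact: filterlim_graph h2.
Qed.

Lemma clamp_velocity_continuous (r : R) : continuous (clamp du) r.
Proof. by apply: clamp_continuous; have [_ [_ [_ [h _]]]] := mild (Rmax_l t0 r). Qed.

Lemma clamp_sqrt_continuous (r : R) : continuous (clamp (fun t => B (u t))) r.
Proof.
apply: clamp_continuous; have [h1 [h2 _]] := mild (Rmax_l t0 r).
exact: (filterlim_op_graph sB h1 (half_line_dom _) h2).
Qed.

Lemma clamp_potential_continuous (r : R) : continuous (clamp (fun t => F (u t))) r.
Proof.
apply: clamp_continuous; have [h1 [h2 _]] := mild (Rmax_l t0 r).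
exact: (filterlim_potential sB F_grad L0_bounded F_lip h1 (half_line_dom _) h2).
Qed.

Lemma clamp_forcing_continuous (r : R) : continuous (clamp forcing) r.
Proof.
apply: clamp_continuous; have [h1 [h2 [_ [h3 _]]]] := mild (Rmax_l t0 r).
apply: filterlim_plus_fun.
  apply: filterlim_scal_fun => //.
  apply: (filterlim_filter_le_1 (F := locally (Rmax t0 r))); first exact: filter_le_within.
  have hm := Rmax_l t0 r.
  apply: (ex_derive_continuous (fun t => alpha / t)); auto_derive; lra.
exact: (filterlim_gradient sB L0_bounded F_lip h1 (half_line_dom _) h2).
Qed.

Arguments clamp_position_continuous : clear implicits.
Arguments clamp_velocity_continuous : clear implicits.
Arguments clamp_sqrt_continuous : clear implicits.
Arguments clamp_potential_continuous : clear implicits.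
Arguments clamp_forcing_continuous : clear implicits.

Lemma clamp_inside {V : UniformSpace} (g : R -> V) (t : R) : t0 < t ->
  continuous (clamp g) t -> continuous g t.
Proof.
move=> ht; have ht' : 0 < t - t0 by lra.
apply: continuous_ext_loc; apply: (locally_near ht') => r /Rabs_def2 hr.
by rewrite clampE //; lra.
Qed.

Lemma half_line_inside (t : R) (Q : R -> Prop) : t0 < t ->
  half_line_nbhs t0 t Q -> locally t Q.
Proof.
move=> ht h; have ht' : 0 < t - t0 by lra.
have h1 : locally t (fun r => t0 <= r).
  by apply: (locally_near ht') => r /Rabs_def2; lra.
have h2 : locally t (fun r => t0 <= r -> Q r) := h.
by apply: (filter_imp _ _ _ (filter_and _ _ h1 h2)) => r [q1 q2]; apply: q2.
Qed.

Lemma mild_derive (t : R) : t0 < t -> is_derive u t (du t).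
Proof.
move=> ht; have [_ [_ [[h1 h2] _]]] := mild (Rlt_le _ _ ht).
split; first exact: is_linear_scal_l.
move=> x hx e; apply: (half_line_inside ht); apply: h2.
by move=> Q hQ; apply: filter_le_within; apply: hx.
Qed.

Lemma mild_potential_derive (t : R) : t0 < t ->
  is_derive (fun r => F (u r)) t (inner (gradF (u t)) (du t)).
Proof.
move=> ht; have [_ [h2 _]] := mild (Rlt_le _ _ ht).
apply: (potential_chain_rule sB F_grad L0_bounded F_lip _ _ (mild_derive ht)).
  by apply: (half_line_inside ht); apply: half_line_dom.
by move=> Q hQ; apply: (half_line_inside ht); apply: h2.
Qed.

Lemma mild_duhamel (t : R) : t0 <= t ->
  let g := fun tau => S (t - tau) (clamp forcing tau) in
  ex_RInt g t0 t /\
  u t = minus (plus (dS (t - t0) u0) (S (t - t0) u1)) (RInt g t0 t).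
Proof.
move=> ht g; have [_ [_ [_ [_ [h1 h2]]]]] := mild ht.
have e x : Rmin t0 t < x < Rmax t0 t ->
    S (t - x) (plus (scal (alpha / x) (du x)) (gradF (u x))) = g x.
  by rewrite Rmin_left // => hx; rewrite /g clampE //; lra.
split; first by apply: ex_RInt_ext h1.
by rewrite {1}h2; congr (minus _ _); apply: RInt_ext.
Qed.

Lemma mild_weak : weak_solution B t0 u du forcing.
Proof.
apply: (weak_solution_of_core (core_approximation sA hB hS)) => t ht.
have ht' := Rlt_le _ _ ht.
split; first exact: mild_dom.
split; first exact: mild_derive.
split; first exact: (clamp_inside ht (clamp_sqrt_continuous t)).
split; first exact: (clamp_inside ht (clamp_velocity_continuous t)).
split; first exact: (clamp_inside ht (clamp_forcing_continuous t)).
move=> v hv; have [hv' _] := sqrt_dom hB hv.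
have ht2 : 0 < t - t0 by lra.
apply: (is_derive_ext_loc (tested_velocity B S dS t0 u0 u1 (clamp forcing) v)).
  apply: (locally_near ht2) => r /Rabs_def2 hr; have hr0 : t0 < r by lra.
  by rewrite (tested_velocityE sA hB hS hu0 clamp_forcing_continuous mild_duhamel hv' hr0 (mild_derive hr0)).
rewrite (inner_sym (B (u t))) -(inner_sqrt hB hv (mild_dom ht')) (inner_sym (A v)) -(clampE forcing ht').
exact: (is_derive_tested_velocity sA hB hS hu0 clamp_forcing_continuous mild_duhamel hv ht').
Qed.

Lemma mild_initial_position : u t0 = u0.
Proof.
have [_ ->] := mild_duhamel (Rle_refl t0).
rewrite RInt_point Rminus_diag (dS_0 hS hu0) (S_0_all sA hB hS) minus_zero_r.
exact: plus_zero_r.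
Qed.

(* Duhamel's formula determines the velocity only for later times; the initial
   value is recovered as a limit. *)
Lemma mild_initial_velocity : du t0 = u1.
Proof.
have e : minus (du t0) u1 = zero.
  apply: (orth_dense (proj1 (proj2 sB))) => v hv; rewrite inner_minus_l.
  set m := tested_velocity B S dS t0 u0 u1 (clamp forcing) v.
  have c1 : filterlim (fun r => inner (clamp du r) v) (at_right t0) (locally (inner (clamp du t0) v)).
    apply: (filterlim_filter_le_1 (F := locally t0)); first exact: filter_le_within.
    by apply: filterlim_inner; [apply: clamp_velocity_continuous | apply: filterlim_const].
  have c2 : filterlim m (at_right t0) (locally (m t0)).
    apply: (filterlim_filter_le_1 (F := locally t0)); first exact: filter_le_within.
    exact: (is_derive_continuous (is_derive_tested_velocity_raw hS t0 u0 u1 clamp_forcing_continuous t0 hv)).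
  have c3 : filterlim m (at_right t0) (locally (inner (clamp du t0) v)).
    apply: filterlim_ext_loc c1; rewrite /at_right /within; apply: filter_forall => r hr.
    rewrite clampE; last lra.
    exact: (tested_velocityE sA hB hS hu0 clamp_forcing_continuous mild_duhamel hv hr (mild_derive hr)).
  have pf : ProperFilter' (at_right t0) by apply: Proper_StrongProper.
  have := filterlim_locally_unique (FF := pf) _ _ _ c2 c3.
  rewrite /m (tested_velocity0 hB hS t0 u0 u1 _ hv) clampE //; lra.
by rewrite -(plus_zero_r u1) -e /minus (plus_comm (du t0)) plus_assoc plus_opp_r plus_zero_l.
Qed.

End Mild.

Arguments clamp_position_continuous {H B S dS gradF alpha t0 u0 u1 u du} mild r.
Arguments clamp_velocity_continuous {H B S dS gradF alpha t0 u0 u1 u du} mild r.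
Arguments clamp_sqrt_continuous {H A B S dS gradF alpha t0 u0 u1 u du} hB mild r.
Arguments clamp_potential_continuous {H A B S dS F gradF L0 alpha t0 u0 u1 u du}
  hB F_grad L0_bounded F_lip mild r.

(** * Upper estimate *)

Lemma Rpower_gt0 (x p : R) : 0 < Rpower x p.
Proof. exact: exp_pos. Qed.

Lemma rpowE (x p : R) : 0 < x -> rpow x p = Rpower x p.
Proof. by move=> hx; rewrite /rpow; case: Rle_dec => // h; lra. Qed.

Lemma rpow_ge0 (x p : R) : 0 <= rpow x p.
Proof. by rewrite /rpow; case: Rle_dec => h; [lra | left; apply: Rpower_gt0]. Qed.

Lemma is_derive_Rpower (p t : R) : 0 < t ->
  is_derive (fun r => Rpower r p) t (p * Rpower t (p - 1)).
Proof. by move=> ht; apply/is_derive_Reals; apply: derivable_pt_lim_power. Qed.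

Lemma Rpower_le_antitone (x y p : R) : p <= 0 -> 0 < x <= y -> Rpower y p <= Rpower x p.
Proof.
move=> hp hxy; have -> : p = - (- p) by ring.
rewrite !(Rpower_Ropp _ (- p)); apply: Rinv_le_contravar; first exact: Rpower_gt0.
by apply: Rle_Rpower_l; lra.
Qed.

Lemma clamp_of_derivable (t0 : R) (g : R -> R) (r : R) : 0 < t0 ->
  (forall t, 0 < t -> ex_derive g t) -> continuous (clamp t0 g) r.
Proof.
move=> ht0 h; apply: clamp_continuous.
apply: (filterlim_filter_le_1 (F := locally (Rmax t0 r))); first exact: filter_le_within.
by apply: ex_derive_continuous; apply: h; have := Rmax_l t0 r; lra.
Qed.

Lemma nondecreasing_half_line (f df : R -> R) (t0 t1 t2 : R) :
  (forall r, continuous (clamp t0 f) r) ->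
  (forall r, t0 < r -> is_derive f r (df r)) ->
  (forall r, t0 < r -> 0 <= df r) -> t0 <= t1 <= t2 -> f t1 <= f t2.
Proof.
move=> hc hd hp h12.
rewrite -(clampE (t0 := t0) f (r := t1)) -1?(clampE (t0 := t0) f (r := t2)); try lra.
apply: (nondecreasing_of_derive (f := clamp t0 f) (df := df)) => [|r hr|r hr|r hr]; first lra.
- exact: hc.
- have hr0 : t0 < r by lra.
  apply: (is_derive_ext_loc f); last exact: hd.
  have hr' : 0 < r - t0 by lra.
  by apply: (locally_near hr') => p /Rabs_def2 hp'; rewrite clampE //; lra.
- by apply: hp; lra.
Qed.

(** Young's inequality with the coercivity bound n^s <= K G: a multiple of n^2
    is absorbed by t^2 G up to a power of t. *)
Lemma coercive_absorption (s K D d : R) : 2 < s -> 0 < K -> 0 < D -> 0 < d ->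
  exists C, 0 < C /\ forall t n G, 0 < t -> 0 <= n -> rpow n s <= K * G ->
    D * n ^ 2 <= d * (t ^ 2 * G) + C * Rpower t (- (4 / (s - 2))).
Proof.
move=> hs hK hD hd; set q := 2 / (s - 2).
have hq : 0 < q by apply: Rdiv_lt_0_compat; lra.
have hDK : 0 < D * K / d by apply: Rdiv_lt_0_compat => //; apply: Rmult_lt_0_compat.
exists (D * Rpower (D * K / d) q); split.
  by apply: Rmult_lt_0_compat => //; apply: Rpower_gt0.
move=> t n G ht hn hG.
have hG0 : 0 <= G.
  have := rpow_ge0 n s => h.
  by apply: (Rmult_le_reg_l K) => //; lra.
have ht2 : 0 < t ^ 2 by apply: pow_lt.
have p1 : 0 <= d * (t ^ 2 * G).
  by apply: Rmult_le_pos; [lra | apply: Rmult_le_pos; lra].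
have p2 : 0 < D * Rpower (D * K / d) q * Rpower t (- (4 / (s - 2))).
  by do 2 (apply: Rmult_lt_0_compat; last exact: Rpower_gt0).
case: (Rle_dec (D * n ^ 2) (d * (t ^ 2 * G))) => [|hlt]; first lra.
have hn0 : 0 < n.
  case: (Req_dec n 0) => hn0; last lra.
  by exfalso; apply: hlt; rewrite hn0; lra.
rewrite rpowE // in hG.
have en : Rpower n s = n ^ 2 * Rpower n (s - 2).
  have -> : n ^ 2 = Rpower n 2 by rewrite -(Rpower_pow 2 n hn0) /=; congr Rpower; ring.
  by rewrite -Rpower_plus; congr Rpower; ring.
have hn2 : 0 < n ^ 2 by apply: pow_lt.
have h1 : Rpower n (s - 2) <= D * K / d * Rpower t (- 2).
  have -> : Rpower t (- 2) = / t ^ 2.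
    by rewrite Rpower_Ropp; congr (/ _); rewrite -(Rpower_pow 2 t ht) /=; congr Rpower; ring.
  apply: (Rmult_le_reg_l (n ^ 2)) => //; rewrite -en.
  apply: (Rle_trans _ (K * G)) => //.
  apply: (Rmult_le_reg_l (d * t ^ 2)); first exact: Rmult_lt_0_compat.
  have -> : d * t ^ 2 * (n ^ 2 * (D * K / d * / t ^ 2)) = K * (D * n ^ 2).
    by field; split; lra.
  have -> : d * t ^ 2 * (K * G) = K * (d * (t ^ 2 * G)) by ring.
  by apply: Rmult_le_compat_l; lra.
have h2 := Rle_Rpower_l _ _ q (Rlt_le _ _ hq) (conj (Rpower_gt0 n (s - 2)) h1).
rewrite Rpower_mult -Rpower_mult_distr // ?Rpower_mult in h2; last exact: Rpower_gt0.
have e1 : Rpower n ((s - 2) * q) = n ^ 2.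
  rewrite -(Rpower_pow 2 n hn0) /=; congr Rpower; rewrite /q; field; lra.
have e2 : - 2 * q = - (4 / (s - 2)) by rewrite /q; field; lra.
rewrite e1 e2 in h2.
have := Rmult_le_compat_l D _ _ (Rlt_le _ _ hD) h2; lra.
Qed.

Section UpperEstimate.

Variables (s alpha eps K : R).
Hypotheses (hs : 2 < s) (ha0 : 0 < alpha) (ha : alpha <= 2 * s / (s - 2))
  (heps : 0 < eps) (hK : 0 < K).

Let lam := alpha / 2 + eps.
Let xi := lam * (lam + 1 - alpha).
Let eta := alpha - 2 - 2 * eps.
Let kap := 2 * s / (s - 2) + 2 * eps - alpha.

Let kap_gt0 : 0 < kap.
Proof. by rewrite /kap; lra. Qed.

(** E_lambda in terms of X = |u|^2, Y = <u, u'>, N = |u'|^2, G = |A^{1/2} u|^2,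
    V = F(u). *)
Definition lyapunov (X Y N G V : R -> R) (t : R) : R :=
  t ^ 2 * (/ 2 * N t + / 2 * G t + V t) + lam * t * Y t + (lam ^ 2 + xi) / 2 * X t.

(** The powers of t and the value of lam are chosen so that in the derivative of
    t^eta E_lambda the square |lam u + t u'|^2 cancels and G is left with the
    coefficient -2 eps t^(eta + 1). The number kap is the rate at which the
    absorbed term decays after multiplication by t^eta: it is what remains of the
    inequality between alpha and 2 s / (s - 2), with a margin 2 eps that keeps it
    positive in the limiting case. *)
Lemma upper_estimate : exists C, 0 < C /\
  forall (t0 : R) (X Y N G V p n : R -> R), 0 < t0 ->
  (forall r, continuous (clamp t0 X) r) ->
  (forall r, continuous (clamp t0 Y) r) ->
  (forall r, continuous (clamp t0 (fun t => / 2 * N t + / 2 * G t + V t)) r) ->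
  (forall t, t0 < t -> is_derive X t (2 * Y t)) ->
  (forall t, t0 < t -> is_derive Y t (N t - G t - alpha / t * Y t - p t)) ->
  (forall t, t0 < t ->
     is_derive (fun t => / 2 * N t + / 2 * G t + V t) t (- (alpha / t) * N t)) ->
  (forall t, t0 <= t -> 0 <= n t /\ X t = n t ^ 2 /\ 0 <= G t /\ 0 <= V t /\
     s * V t <= p t /\ rpow (n t) s <= K * (G t + V t) /\
     0 <= lam ^ 2 * X t + 2 * lam * t * Y t + t ^ 2 * N t) ->
  forall t, t0 <= t ->
    V t + G t <= 4 * (Rpower t0 eta * lyapunov X Y N G V t0) * Rpower t (- alpha + 2 * eps)
      + C * Rpower t0 (alpha - 2 * s / (s - 2) - 2 * eps) * Rpower t (- alpha + 2 * eps).
Proof.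
have hxi := Rabs_pos xi.
have [] := coercive_absorption (D := (1 + 2 * eps) * Rabs xi + 1) (d := 2 * eps) hs hK; try nra.
move=> C1 [hC1 abs1].
have [] := coercive_absorption (D := / 2 * Rabs xi + 1) (d := / 4) hs hK; try lra.
move=> C2 [hC2 abs2].
have hC1k : 0 < C1 / kap by apply: Rdiv_lt_0_compat.
exists (4 * (C1 / kap + C2)); split; first lra.
move=> t0 X Y N G V p n ht0 cX cY cE dX dY dE pw t ht.
(* the second term has derivative -C1 r^(-kap-1), which cancels what the
   absorption leaves *)
pose h r := Rpower r eta * lyapunov X Y N G V r + C1 / kap * Rpower r (- kap).
pose dlya r := 2 * r * (/ 2 * N r + / 2 * G r + V r) + r ^ 2 * (- (alpha / r) * N r)
   + (lam * Y r + lam * r * (N r - G r - alpha / r * Y r - p r))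
   + (lam ^ 2 + xi) / 2 * (2 * Y r).
pose dh r := eta * Rpower r (eta - 1) * lyapunov X Y N G V r + Rpower r eta * dlya r
   + C1 / kap * (- kap * Rpower r (- kap - 1)).
have dlyaE r : t0 < r -> is_derive (lyapunov X Y N G V) r (dlya r).
  move=> hr.
  have d1 : is_derive (fun r : R => r ^ 2) r (2 * r) by auto_derive; [|ring].
  have d2 : is_derive (fun r : R => lam * r) r lam by auto_derive; [|ring].
  have d3 : is_derive (fun r : R => (lam ^ 2 + xi) / 2) r 0 by apply: is_derive_const.
  have m1 := is_derive_mult _ _ _ _ _ d1 (dE r hr) Rmult_comm.
  have m2 := is_derive_mult _ _ _ _ _ d2 (dY r hr) Rmult_comm.
  have m3 := is_derive_mult _ _ _ _ _ d3 (dX r hr) Rmult_comm.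
  have := is_derive_plus _ _ _ _ _ (is_derive_plus _ _ _ _ _ m1 m2) m3.
  congr is_derive; rewrite /plus /mult /= /dlya; field; lra.
have dhE r : t0 < r -> is_derive h r (dh r).
  move=> hr; have hr0 : 0 < r by lra.
  have m1 := is_derive_mult _ _ _ _ _ (is_derive_Rpower eta hr0) (dlyaE r hr) Rmult_comm.
  have m2 := is_derive_scal _ _ (C1 / kap) _ (is_derive_Rpower (- kap) hr0).
  exact: is_derive_plus m1 m2.
have dh_le0 r : t0 < r -> dh r <= 0.
  move=> hr; have hr0 : 0 < r by lra.
  have [n0 [eX [G0 [V0 [sV [cn _]]]]]] := pw r (Rlt_le _ _ hr).
  have eeta : Rpower r eta = r * Rpower r (eta - 1).
    by rewrite -{2}(Rpower_1 r hr0) -Rpower_plus; congr Rpower; ring.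
  have ekap : Rpower r (- kap - 1) = Rpower r (eta - 1) * Rpower r (- (4 / (s - 2))).
    by rewrite -Rpower_plus; congr Rpower; rewrite /kap /eta; field; lra.
  have -> : dh r = Rpower r (eta - 1) *
      ((eta + 2) * (r ^ 2 * V r) - lam * (r ^ 2 * p r) - 2 * eps * (r ^ 2 * G r)
       - (1 + 2 * eps) * xi * X r - C1 * Rpower r (- (4 / (s - 2)))).
    rewrite /dh /dlya /lyapunov eeta ekap /xi /eta /lam.
    by field; split => //; lra.
  suff : (eta + 2) * (r ^ 2 * V r) - lam * (r ^ 2 * p r) - 2 * eps * (r ^ 2 * G r)
       - (1 + 2 * eps) * xi * X r - C1 * Rpower r (- (4 / (s - 2))) <= 0.
    by have := Rpower_gt0 r (eta - 1); nra.
  have h1 := abs1 r (n r) (G r + V r) hr0 n0 cn.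
  rewrite -eX in h1.
  have X0 : 0 <= X r by rewrite eX; apply: pow2_ge_0.
  have h2 : - xi * X r <= Rabs xi * X r.
    by apply: Rmult_le_compat_r => //; rewrite -Rabs_Ropp; apply: Rle_abs.
  have r2 : 0 < r ^ 2 by apply: pow_lt.
  have h3 : lam * s * (r ^ 2 * V r) <= lam * (r ^ 2 * p r).
    rewrite /lam; have : r ^ 2 * (s * V r) <= r ^ 2 * p r by apply: Rmult_le_compat_l; lra.
    by nra.
  have h4 : 0 <= r ^ 2 * V r by apply: Rmult_le_pos; lra.
  have h5 : eta + 2 - lam * s <= - (2 * eps) by rewrite /eta /lam; nra.
  have h6 : (eta + 2 - lam * s) * (r ^ 2 * V r) <= - (2 * eps) * (r ^ 2 * V r).
    exact: Rmult_le_compat_r.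
  have h7 : (1 + 2 * eps) * (- xi * X r) <= (1 + 2 * eps) * (Rabs xi * X r).
    by apply: Rmult_le_compat_l; lra.
  lra.
have hdec : h t <= h t0.
  have := nondecreasing_half_line (f := fun r => - h r) (df := fun r => - dh r) (t0 := t0) (t1 := t0) (t2 := t).
  move=> H; suff : - h t0 <= - h t by lra.
  apply: H => [r|r hr|r hr|]; last lra.
  - apply: (continuous_opp (V := R_NormedModule) (clamp t0 h)).
    have c1 q : continuous (clamp t0 (fun r => Rpower r q)) r.
      by apply: clamp_of_derivable => // x hx; eexists; apply: is_derive_Rpower.
    have c2 : continuous (clamp t0 (fun r => r ^ 2)) r.
      by apply: clamp_of_derivable => // x hx; auto_derive.
    have c3 : continuous (clamp t0 (fun r => lam * r)) r.
      by apply: clamp_of_derivable => // x hx; auto_derive.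
    apply: filterlim_Rplus.
      apply: filterlim_Rmult; first exact: c1.
      apply: filterlim_Rplus; first apply: filterlim_Rplus; apply: filterlim_Rmult.
      + exact: c2.
      + exact: cE.
      + exact: c3.
      + exact: cY.
      + exact: filterlim_const.
      + exact: cX.
    by apply: filterlim_Rmult; [apply: filterlim_const | apply: c1].
  - exact: (is_derive_opp (V := R_NormedModule) h) (dhE r hr).
  - by have := dh_le0 r hr; lra.
have ht' : 0 < t by lra.
have [n0 [eX [G0 [V0 [sV [cn sq]]]]]] := pw t ht.
have X0 : 0 <= X t by rewrite eX; apply: pow2_ge_0.
have h1 := abs2 t (n t) (G t + V t) ht' n0 cn; rewrite -eX in h1.
have h2 : - xi * X t <= Rabs xi * X t.
  by apply: Rmult_le_compat_r => //; rewrite -Rabs_Ropp; apply: Rle_abs.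
have t2 : 0 < t ^ 2 by apply: pow_lt.
have h4 : 0 <= t ^ 2 * V t by apply: Rmult_le_pos; lra.
(* half of t^2 (G + V) survives after dropping the square; a quarter pays for the
   negative part of the |u|^2 term *)
have low : / 4 * (t ^ 2 * (G t + V t)) - C2 * Rpower t (- (4 / (s - 2))) <= lyapunov X Y N G V t.
  rewrite /lyapunov; lra.
have ekap : Rpower t (- kap) = Rpower t eta * Rpower t (- (4 / (s - 2))).
  by rewrite -Rpower_plus; congr Rpower; rewrite /kap /eta; field; lra.
have ekap0 : alpha - 2 * s / (s - 2) - 2 * eps = - kap by rewrite /kap; ring.
have hk : Rpower t (- kap) <= Rpower t0 (- kap) by apply: Rpower_le_antitone; lra.
have pt := Rpower_gt0 t (- kap).
have low2 := Rmult_le_compat_l _ _ _ (Rlt_le _ _ (Rpower_gt0 t eta)) low.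
have main : / 4 * (Rpower t eta * t ^ 2 * (G t + V t))
   <= Rpower t0 eta * lyapunov X Y N G V t0 + (C1 / kap + C2) * Rpower t0 (- kap).
  move: hdec; rewrite /h => hdec.
  have := Rmult_le_compat_l _ _ _ (Rlt_le _ _ hC2) hk.
  have := Rmult_lt_0_compat _ _ hC1k pt.
  rewrite ekap; rewrite ekap in hdec; nra.
have ealpha : Rpower t (- alpha + 2 * eps) * (Rpower t eta * t ^ 2) = 1.
  rewrite -(Rpower_pow 2 t ht') -!Rpower_plus -(Rpower_O t ht') /eta; congr Rpower; rewrite /=; ring.
rewrite ekap0.
have := Rmult_le_compat_l _ _ _ (Rlt_le _ _ (Rpower_gt0 t (- alpha + 2 * eps))) main.
have -> : Rpower t (- alpha + 2 * eps) * (/ 4 * (Rpower t eta * t ^ 2 * (G t + V t)))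
  = / 4 * (Rpower t (- alpha + 2 * eps) * (Rpower t eta * t ^ 2)) * (G t + V t) by ring.
rewrite ealpha; lra.
Qed.

End UpperEstimate.

(** * Lower estimate *)

Lemma Rpower_pred (t a : R) : 0 < t -> Rpower t (a - 1) = Rpower t a / t.
Proof.
by move=> ht; rewrite /Rminus Rpower_plus Rpower_Ropp Rpower_1.
Qed.

Section LowerEstimate.

Variables (t0 alpha k g0 T0 Cg p : R) (N G Y q1 q2 g : R -> R).
Hypotheses (ht0 : 0 < t0) (ha : 0 < alpha) (hk : 0 <= k) (hp : 1 < p <= 2) (hCg : 0 <= Cg).

Let e t := / 2 * N t + / 2 * G t.

Hypotheses (ce : forall r, continuous (clamp t0 (fun t => / 2 * N t + / 2 * G t)) r)
  (de : forall t, t0 < t ->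
     is_derive (fun t => / 2 * N t + / 2 * G t) t (- (alpha / t) * N t - q1 t))
  (dY : forall t, t0 < t -> is_derive Y t (N t - G t - alpha / t * Y t - q2 t))
  (pw : forall t, t0 <= t -> 0 <= N t /\ 0 <= G t /\ Rabs (Y t) <= k * e t /\
     Rabs (q1 t) <= g t * e t /\ Rabs (q2 t) <= 2 * k * g t * e t)
  (g_bounded : forall t, t0 <= t -> 0 <= g t <= g0)
  (g_decay : forall t, t0 <= t -> T0 <= t -> g t <= Cg * Rpower t (- p))
  (e0 : 0 < / 2 * N t0 + / 2 * G t0).

(** Backward uniqueness by Gronwall's inequality: damping and perturbation destroy
    energy at a bounded relative rate. *)
Lemma oscillation_energy_pos (t : R) : t0 <= t -> 0 < e t.
Proof.
move=> ht; pose L := 2 * alpha / t0 + g0.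
have h : e t0 * exp (L * t0) <= e t * exp (L * t).
  apply: (nondecreasing_half_line (t0 := t0) (f := fun t => e t * exp (L * t))
    (df := fun t => (- (alpha / t) * N t - q1 t) * exp (L * t) + e t * (L * exp (L * t))))
    => [r|r hr|r hr|]; last lra.
  - apply: filterlim_Rmult; first exact: ce.
    by apply: (clamp_of_derivable (g := fun t => exp (L * t))) => // x _; auto_derive.
  - have d1 : is_derive (fun t => exp (L * t)) r (L * exp (L * r)).
      by auto_derive; [|ring].
    exact: (is_derive_mult _ _ _ _ _ (de hr) d1 Rmult_comm).
  - have hr' := Rlt_le _ _ hr.
    have [N0 [G0 [_ [hq1 _]]]] := pw hr'; have [_ hg] := g_bounded hr'.
    have -> : (- (alpha / r) * N r - q1 r) * exp (L * r) + e r * (L * exp (L * r))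
       = exp (L * r) * (- (alpha / r) * N r - q1 r + e r * L) by ring.
    apply: Rmult_le_pos; first by left; apply: exp_pos.
    have hE : 0 <= e r by rewrite /e; lra.
    have h1 : alpha / r <= alpha / t0.
      by apply: Rmult_le_compat_l; [lra | apply: Rinv_le_contravar; lra].
    have h2 : alpha / r * N r <= alpha / t0 * (2 * e r).
      apply: Rmult_le_compat => //; last by rewrite /e; lra.
      by left; apply: Rdiv_lt_0_compat; lra.
    have h3 : q1 r <= g0 * e r.
      apply: Rle_trans (Rle_abs _) _; apply: (Rle_trans _ _ _ hq1).
      exact: Rmult_le_compat_r.
    have -> : e r * L = alpha / t0 * (2 * e r) + g0 * e r by rewrite /L; field; lra.
    lra.
have h0 : 0 < e t0 * exp (L * t0) by apply: Rmult_lt_0_compat => //; apply: exp_pos.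
have h1 := exp_pos (L * t); nra.
Qed.

(** Decay of e exactly like t^(-alpha) would need the dissipation (alpha/t) e, while
    the damping gives (alpha/t) N. The difference is (alpha/2t) (N - G), and by
    the equation for Y = <w, w'> this is the derivative of (alpha/2t) Y up to
    small terms. Correcting t^alpha e by this cross term leaves a quantity with
    logarithmic derivative O(t^(-p)), where p > 1. *)
Lemma oscillation_lower_bound : exists c T, 0 < c /\ t0 <= T /\
  forall t, T <= t -> c * Rpower t (- alpha) <= e t.
Proof.
(* beyond alpha k the correction is at most half of the energy *)
pose T := t0 + Rabs T0 + 1 + alpha * k.
have hak : 0 <= alpha * k by apply: Rmult_le_pos; lra.
have hT0 := Rabs_pos T0; have hT0' := Rle_abs T0.
pose psi t := Rpower t alpha * e t + alpha / 2 * (Rpower t (alpha - 1) * Y t).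
pose M := alpha * k + 4 * Cg.
pose m := M / (p - 1).
have hM : 0 <= M by rewrite /M; lra.
have hm : 0 <= m by apply: Rmult_le_pos => //; left; apply: Rinv_0_lt_compat; lra.
have later t : T <= t -> t0 < t /\ 1 <= t /\ T0 <= t /\ alpha * k <= t by rewrite /T; lra.
have psi_bounds t : T <= t ->
    Rpower t alpha * e t <= 2 * psi t /\ psi t <= 3 / 2 * (Rpower t alpha * e t).
  move=> /later [h1 [h2 [h3 h4]]].
  have [N0 [G0 [hY _]]] := pw (Rlt_le _ _ h1).
  have e1 : Rpower t (alpha - 1) = Rpower t alpha / t by apply: Rpower_pred; lra.
  have hE := oscillation_energy_pos (Rlt_le _ _ h1).
  have hb : Rabs (alpha / 2 * (Rpower t (alpha - 1) * Y t)) <= / 2 * (Rpower t alpha * e t).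
    rewrite e1; have -> : alpha / 2 * (Rpower t alpha / t * Y t) = / 2 * Rpower t alpha * (alpha / t * Y t).
      by field; lra.
    have ha1 : 0 < alpha / t by apply: Rdiv_lt_0_compat; lra.
    have hpa := Rpower_gt0 t alpha.
    rewrite Rabs_mult (Rabs_pos_eq (/ 2 * _)); last lra.
    rewrite Rmult_assoc; apply: Rmult_le_compat_l; first lra.
    apply: Rmult_le_compat_l; first lra.
    rewrite Rabs_mult (Rabs_pos_eq (alpha / t)); last lra.
    apply: (Rle_trans _ (alpha / t * (k * e t))); first by apply: Rmult_le_compat_l; lra.
    have -> : alpha / t * (k * e t) = alpha * k / t * e t by field; lra.
    rewrite -{2}(Rmult_1_l (e t)); apply: Rmult_le_compat_r; first lra.
    apply: (Rmult_le_reg_r t); first lra.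
    have -> : alpha * k / t * t = alpha * k by field; lra.
    lra.
  have := Rle_abs (alpha / 2 * (Rpower t (alpha - 1) * Y t)).
  have := Rabs_maj2 (alpha / 2 * (Rpower t (alpha - 1) * Y t)).
  rewrite /psi; lra.
pose dpsi t := Rpower t alpha * (- (alpha / (2 * t ^ 2)) * Y t - q1 t - alpha / (2 * t) * q2 t).
have dpsiE t : t0 < t -> is_derive psi t (dpsi t).
  move=> ht; have ht' : 0 < t by lra.
  have m1 := is_derive_mult _ _ _ _ _ (is_derive_Rpower alpha ht') (de ht) Rmult_comm.
  have m2 := is_derive_mult _ _ _ _ _ (is_derive_Rpower (alpha - 1) ht') (dY ht) Rmult_comm.
  have := is_derive_plus _ _ _ _ _ m1 (is_derive_scal _ _ (alpha / 2) _ m2).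
  congr is_derive; rewrite /plus /mult /= /dpsi /e.
  rewrite !Rpower_pred //; field; lra.
have dpsi_le t : T <= t -> - dpsi t <= M * Rpower t (- p) * psi t.
  move=> hT; have [h1 [h2 [h3 h4]]] := later t hT; have h1' := Rlt_le _ _ h1.
  have [N0 [G0 [hY [hq1 hq2]]]] := pw h1'; have [g1 _] := g_bounded h1'.
  have hg := g_decay h1' h3.
  have hE := oscillation_energy_pos h1'.
  have [b1 _] := psi_bounds t hT.
  have hpa := Rpower_gt0 t alpha; have ht : 0 < t by lra.
  have hpe : 0 < Rpower t alpha * e t by apply: Rmult_lt_0_compat.
  have hit : 0 < / t by apply: Rinv_0_lt_compat.
  have hpt : Rpower t (- 2) <= Rpower t (- p) by apply: Rle_Rpower; lra.
  have e2 : Rpower t (- 2) = / t * / t.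
    have -> : - 2 = 0 - 1 - 1 by ring.
    by rewrite !Rpower_pred // Rpower_O //; field; lra.
  have k1 : alpha * k * / t <= 1.
    apply: (Rmult_le_reg_r t) => //.
    by rewrite Rmult_assoc Rinv_l; lra.
  have y1 : alpha / (2 * t ^ 2) * Y t <= alpha * k / 2 * Rpower t (- p) * e t.
    have y2 := Rle_trans _ _ _ (Rle_abs _) hY.
    have -> : alpha / (2 * t ^ 2) * Y t = / 2 * alpha * (/ t * / t) * Y t by field; lra.
    apply: (Rle_trans _ (/ 2 * alpha * (/ t * / t) * (k * e t))).
      by apply: Rmult_le_compat_l => //; apply: Rmult_le_pos; [lra | nra].
    have -> : / 2 * alpha * (/ t * / t) * (k * e t) = / 2 * (alpha * k) * e t * (/ t * / t) by ring.
    have -> : alpha * k / 2 * Rpower t (- p) * e t = / 2 * (alpha * k) * e t * Rpower t (- p) by field.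
    apply: Rmult_le_compat_l; last lra.
    by apply: Rmult_le_pos; lra.
  have y3 : q1 t <= Cg * Rpower t (- p) * e t.
    apply: Rle_trans (Rle_abs _) _; apply: (Rle_trans _ _ _ hq1).
    by apply: Rmult_le_compat_r; lra.
  have y4 : alpha / (2 * t) * q2 t <= Cg * Rpower t (- p) * e t.
    have y5 := Rle_trans _ _ _ (Rle_abs _) hq2.
    have -> : alpha / (2 * t) * q2 t = / 2 * alpha * / t * q2 t by field; lra.
    apply: (Rle_trans _ (/ 2 * alpha * / t * (2 * k * g t * e t))).
      by apply: Rmult_le_compat_l => //; nra.
    have -> : / 2 * alpha * / t * (2 * k * g t * e t) = alpha * k * / t * (g t * e t) by field; lra.
    have ge : 0 <= g t * e t by apply: Rmult_le_pos; lra.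
    apply: (Rle_trans _ (1 * (g t * e t))); first exact: Rmult_le_compat_r.
    by rewrite Rmult_1_l; apply: Rmult_le_compat_r; lra.
  apply: (Rle_trans _ (M * Rpower t (- p) * (/ 2 * (Rpower t alpha * e t)))).
    have -> : - dpsi t = Rpower t alpha * (alpha / (2 * t ^ 2) * Y t + q1 t + alpha / (2 * t) * q2 t).
      by rewrite /dpsi; field; lra.
    have -> : M * Rpower t (- p) * (/ 2 * (Rpower t alpha * e t)) = Rpower t alpha *
       (alpha * k / 2 * Rpower t (- p) * e t + Cg * Rpower t (- p) * e t + Cg * Rpower t (- p) * e t).
      by rewrite /M; field.
    by apply: Rmult_le_compat_l; lra.
  apply: Rmult_le_compat_l; last lra.
  by apply: Rmult_le_pos => //; left; apply: Rpower_gt0.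
(* the integrating factor of the inequality dpsi_le; it is at most 1 and increases *)
pose w t := exp (- m * Rpower t (1 - p)).
have dwE t : 0 < t -> is_derive w t (M * Rpower t (- p) * w t).
  move=> ht.
  have h1 : is_derive exp (- m * Rpower t (1 - p)) (exp (- m * Rpower t (1 - p))).
    by apply/is_derive_Reals; apply: derivable_pt_lim_exp.
  have := is_derive_comp exp _ t _ _ h1 (is_derive_scal _ _ (- m) _ (is_derive_Rpower (1 - p) ht)).
  congr is_derive; rewrite /scal /= /mult /= -/(w t).
  have -> : 1 - p - 1 = - p by ring.
  by rewrite /m; field; lra.
have hTT : T <= T by lra.
have [hT1 _] := later T hTT; have [b1 _] := psi_bounds T hTT.
have hET := oscillation_energy_pos (Rlt_le _ _ hT1).
have psiT : 0 < psi T.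
  by have := Rmult_lt_0_compat _ _ (Rpower_gt0 T alpha) hET; lra.
have wT : 0 < w T := exp_pos _.
exists (2 / 3 * (psi T * w T)), T; split; first nra.
split; first lra.
move=> t hTt.
have mono : psi T * w T <= psi t * w t.
  apply: (nondecreasing_of_derive (f := fun t => psi t * w t)
    (df := fun t => dpsi t * w t + psi t * (M * Rpower t (- p) * w t))) => [|r hr|r hr|r hr] //.
  - have hr1 : t0 < r by lra.
    have hr2 : 0 < r by lra.
    apply: is_derive_continuous.
    exact: (is_derive_mult _ _ _ _ _ (dpsiE r hr1) (dwE r hr2) Rmult_comm).
  - have hr1 : t0 < r by lra.
    have hr2 : 0 < r by lra.
    exact: (is_derive_mult _ _ _ _ _ (dpsiE r hr1) (dwE r hr2) Rmult_comm).
  - have hTr : T <= r by lra.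
    have := dpsi_le r hTr; have wr : 0 < w r := exp_pos _.
    have -> : dpsi r * w r + psi r * (M * Rpower r (- p) * w r)
      = w r * (M * Rpower r (- p) * psi r - - dpsi r) by ring.
    by move=> h; apply: Rmult_le_pos; lra.
have [h1 [h2 _]] := later t hTt.
have [b2 b3] := psi_bounds t hTt.
have hE := oscillation_energy_pos (Rlt_le _ _ h1).
have hpe := Rmult_lt_0_compat _ _ (Rpower_gt0 t alpha) hE.
have w1 : w t <= 1.
  have hz : - m * Rpower t (1 - p) <= 0 by have := Rpower_gt0 t (1 - p); nra.
  rewrite /w -{2}exp_0; case: (Rle_lt_or_eq_dec _ _ hz) => [hz1|hz1].
    by left; apply: exp_increasing.
  by rewrite hz1; right.
have h3 : psi T * w T <= 3 / 2 * (Rpower t alpha * e t).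
  by apply: (Rle_trans _ _ _ mono); nra.
have einv : Rpower t (- alpha) * Rpower t alpha = 1.
  by rewrite -Rpower_plus Rplus_opp_l Rpower_O //; lra.
have h4 := Rmult_le_compat_l _ _ _ (Rlt_le _ _ (Rpower_gt0 t (- alpha))) h3.
have h5 : Rpower t (- alpha) * (3 / 2 * (Rpower t alpha * e t)) = 3 / 2 * e t.
  by transitivity (3 / 2 * (Rpower t (- alpha) * Rpower t alpha) * e t); [ring | rewrite einv; ring].
lra.
Qed.

End LowerEstimate.

Lemma rpow_decay (n a b M t q : R) : 0 < a -> 0 < b -> 0 <= n -> 0 < M ->
  rpow n a <= M * Rpower t (- q) ->
  rpow n b <= Rpower M (b / a) * Rpower t (- (q * (b / a))).
Proof.
move=> ha hb hn hM h.
have hba : 0 <= b / a by left; apply: Rdiv_lt_0_compat.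
case: (Req_dec n 0) => [->|hn0].
  rewrite /rpow; case: Rle_dec => h0; last lra.
  by left; apply: Rmult_lt_0_compat; apply: Rpower_gt0.
have hn1 : 0 < n by lra.
rewrite !rpowE // in h *.
have := Rle_Rpower_l _ _ (b / a) hba (conj (Rpower_gt0 n a) h).
rewrite Rpower_mult -Rpower_mult_distr ?Rpower_mult //; last exact: Rpower_gt0.
have -> : a * (b / a) = b by field; lra.
by have -> : - q * (b / a) = - (q * (b / a)) by ring.
Qed.

(** * The energy of a mild solution and of its oscillating part *)

(** The nonlinearity is of order |u|^(s-2) relative to the oscillation, and |u|^s
    decays at least like t^(-(alpha - 2 eps)); this is where the two cases for alpha and s
    and the bound 1/(4(s-2)) on eps enter. *)
Lemma decay_exponent (s alpha eps : R) : 2 < s ->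
  (2 < alpha /\ 6 < s) \/ ((s + 2) / (s - 2) < alpha /\ s <= 6) ->
  0 < eps < 1 / (4 * (s - 2)) -> 1 < (alpha - 2 * eps) * ((s - 2) / s).
Proof.
move=> hs ha [he0 he].
have h1 : eps * (4 * (s - 2)) < 1.
  have -> : 1 = 1 / (4 * (s - 2)) * (4 * (s - 2)) by field; lra.
  by apply: Rmult_lt_compat_r; lra.
have h2 : s < (alpha - 2 * eps) * (s - 2).
  case: ha => [[h3 h4]|[h3 h4]]; first nra.
  have : s + 2 < alpha * (s - 2).
    have {1}-> : s + 2 = (s + 2) / (s - 2) * (s - 2) by field; lra.
    by apply: Rmult_lt_compat_r; lra.
  by nra.
apply: (Rmult_lt_reg_r s); first lra.
have -> : (alpha - 2 * eps) * ((s - 2) / s) * s = (alpha - 2 * eps) * (s - 2) by field; lra.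
lra.
Qed.

Section Solution.

Variables (H : HilbertSpace) (A B : operator H) (S dS : R -> H -> H)
  (F : H -> R) (gradF : H -> H) (L0 : R -> R -> R) (alpha t0 : R) (u0 u1 : H) (u du : R -> H).
Hypotheses (sA : self_adjoint A) (hB : is_sqrt_operator A B)
  (hS : is_solution_operator A B S dS)
  (F_ge0 : forall v, dom B v -> 0 <= F v)
  (F_grad : has_gradient B F gradF)
  (L0_bounded : forall r, exists M, forall a b,
     0 <= a <= r -> 0 <= b <= r -> L0 a b <= M)
  (F_lip : forall v w, dom B v -> dom B w ->
     norm (minus (gradF v) (gradF w))
       <= L0 (norm1 B v) (norm1 B w) * norm1 B (minus v w))
  (alpha_gt0 : 0 < alpha) (t0_gt0 : 0 < t0) (hu0 : dom B u0)
  (mild : is_mild_solution B S dS gradF (fun t => alpha / t) t0 u0 u1 u du).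

Let weak := mild_weak sA hB hS L0_bounded F_lip t0_gt0 hu0 mild.
Let sB : self_adjoint B := sqrt_self_adjoint hB.

Lemma energy_clamp_continuous (r : R) : continuous (clamp t0 (energy B F u du)) r.
Proof.
have c1 := clamp_velocity_continuous mild r.
have c2 := clamp_sqrt_continuous hB mild r.
have c3 := clamp_potential_continuous hB F_grad L0_bounded F_lip mild r.
have sq (g : R -> H) : continuous (clamp t0 g) r ->
    continuous (fun r => / 2 * norm (clamp t0 g r) ^ 2) r.
  move=> c; apply: filterlim_Rmult; first exact: filterlim_const.
  apply: (filterlim_ext (fun r => inner (clamp t0 g r) (clamp t0 g r))).
    by move=> x; rewrite inner_norm.
  by rewrite -inner_norm; apply: filterlim_inner.
apply: filterlim_Rplus; last exact: c3.
by apply: filterlim_Rplus; [exact: (sq _ c1) | exact: (sq _ c2)].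
Qed.

Arguments energy_clamp_continuous : clear implicits.

Lemma energy_derive (t : R) : t0 < t ->
  is_derive (energy B F u du) t (- (alpha / t) * norm (du t) ^ 2).
Proof.
move=> ht.
have h1 := energy_derivative sB weak ht.
have h2 := mild_potential_derive hB F_grad L0_bounded F_lip mild ht.
have := is_derive_plus _ _ _ _ _ h1 h2; congr is_derive.
rewrite /plus /= /forcing inner_plus_l inner_scal_l inner_norm /=; ring.
Qed.

Lemma energy_nonincreasing (t1 t2 : R) : t0 <= t1 <= t2 ->
  energy B F u du t2 <= energy B F u du t1.
Proof.
move=> h12.
suff : - energy B F u du t1 <= - energy B F u du t2 by lra.
apply: (nondecreasing_half_line (t0 := t0) (f := fun t => - energy B F u du t)
  (df := fun t => alpha / t * norm (du t) ^ 2)) => // [r|r hr|r hr].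
- exact: (continuous_opp (V := R_NormedModule) _ _ (energy_clamp_continuous r)).
- have := is_derive_opp (V := R_NormedModule) _ _ _ (energy_derive hr).
  by congr is_derive; rewrite /opp /=; ring.
- apply: Rmult_le_pos; last exact: pow2_ge_0.
  by left; apply: Rdiv_lt_0_compat; lra.
Qed.

Lemma sqrt_bounded_by_energy (t : R) : t0 <= t ->
  norm (B (u t)) <= sqrt (2 * energy B F u du t0).
Proof.
move=> ht; rewrite -(sqrt_pow2 (norm (B (u t)))); last exact: norm_ge_0.
apply: sqrt_le_1_alt.
have h12 : t0 <= t0 <= t by lra.
have := energy_nonincreasing h12.
have := F_ge0 (mild_dom mild ht); have := pow2_ge_0 (norm (du t)).
rewrite {1}/energy; lra.
Qed.

Lemma energy_lambdaE (lam t : R) :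
  energy_lambda B F alpha lam u du t =
  t ^ 2 * energy B F u du t + lam * t * inner (u t) (du t)
  + (lam ^ 2 + lam * (lam + 1 - alpha)) / 2 * norm (u t) ^ 2.
Proof.
rewrite /energy_lambda /energy -(inner_norm (plus _ _)); inner_expand.
rewrite (inner_sym (du t) (u t)) !inner_norm; field.
Qed.

Lemma position_clamp_continuous (r : R) :
  continuous (clamp t0 (fun t => norm (u t) ^ 2)) r.
Proof.
have c := clamp_position_continuous mild r.
apply: (filterlim_ext (fun r => inner (clamp t0 u r) (clamp t0 u r))).
  by move=> x; rewrite inner_norm.
rewrite [clamp _ _ r]/clamp -inner_norm; exact: filterlim_inner.
Qed.

Lemma cross_clamp_continuous (r : R) :
  continuous (clamp t0 (fun t => inner (u t) (du t))) r.
Proof.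
exact: (filterlim_inner (clamp_position_continuous mild r)
  (clamp_velocity_continuous mild r)).
Qed.

Arguments position_clamp_continuous : clear implicits.
Arguments cross_clamp_continuous : clear implicits.

Lemma cross_derive (t : R) : t0 < t ->
  is_derive (fun t => inner (u t) (du t)) t
    (norm (du t) ^ 2 - norm (B (u t)) ^ 2 - alpha / t * inner (u t) (du t)
     - inner (gradF (u t)) (u t)).
Proof.
move=> ht; have := position_velocity_derivative weak ht; congr is_derive.
rewrite /forcing inner_plus_l inner_scal_l (inner_sym (du t)) /=; ring.
Qed.

(** The part of the solution orthogonal to the kernel oscillates, and the bound on
    Q grad F makes the nonlinearity act on it as a perturbation with an integrable
    coefficient; its energy therefore decays no faster than t^(-alpha). *)
Section Oscillation.

Variables (P : H -> H) (s nu Rvi M q : R).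
Hypotheses (hP : is_orth_projection (ker A) P) (nu_gt0 : 0 < nu) (s_gt2 : 2 < s)
  (gap : forall v, dom B v -> orth (ker A) v -> norm (B v) ^ 2 >= nu * norm v ^ 2)
  (Rvi_gt0 : 0 < Rvi)
  (F_range : forall v, dom B v ->
     norm (minus (gradF v) (P (gradF v)))
       <= Rvi * (rpow (norm v) (s - 2) + rpow (norm (B v)) (s - 2)) * norm (B v))
  (data : ~ (ker A u0 /\ ker A u1))
  (M_gt0 : 0 < M) (hq : 1 < q * ((s - 2) / s))
  (decay_norm : forall t, t0 <= t -> rpow (norm (u t)) s <= M * Rpower t (- q))
  (decay_sqrt : forall t, t0 <= t -> norm (B (u t)) ^ 2 <= M * Rpower t (- q)).

Let w t := coproj P (u t).
Let dw t := coproj P (du t).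
Let f t := coproj P (gradF (u t)).
Let g t := Rvi * (rpow (norm (u t)) (s - 2) + rpow (norm (B (u t))) (s - 2)).

Lemma coproj_forcing (t : R) :
  coproj P (forcing gradF alpha u du t) = plus (scal (alpha / t) (dw t)) (f t).
Proof. exact: (coproj_linear hP). Qed.

Lemma oscillation_initial_energy :
  0 < / 2 * norm (dw t0) ^ 2 + / 2 * norm (B (w t0)) ^ 2.
Proof.
have h1 := pow2_ge_0 (norm (dw t0)); have h2 := pow2_ge_0 (norm (B (w t0))).
case: (Rlt_le_dec 0 (/ 2 * norm (dw t0) ^ 2 + / 2 * norm (B (w t0)) ^ 2)) => // h.
exfalso; apply: data.
have zero_of (x : H) : norm x ^ 2 <= 0 -> x = zero.
  by move=> hx; apply: norm_eq_zero; have := norm_ge_0 (x : H); nra.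
have e1 : dw t0 = zero by apply: zero_of; lra.
have e2 : B (w t0) = zero by apply: zero_of; lra.
have eu := mild_initial_position sA hB hS hu0 mild.
have edu := mild_initial_velocity sA hB hS L0_bounded F_lip t0_gt0 hu0 mild.
have [_ eB] := coproj_sqrt hP hB hu0.
split.
- by apply/(ker_sqrt hB); split => //; rewrite -eB -e2 /w eu.
- have [k1 _] := hP u1.
  have <- : P u1 = u1; last exact: k1.
  have e3 : minus u1 (P u1) = zero by rewrite -[RHS]e1 /dw edu.
  by rewrite -(plus_zero_r (P u1)) -e3 /minus (plus_comm u1) plus_assoc plus_opp_r plus_zero_l.
Qed.

Lemma oscillation_energy_lower : exists c T, 0 < c /\ t0 <= T /\
  0 < energy B F u du T /\
  forall t, T <= t -> c * Rpower t (- alpha) <= energy B F u du t.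
Proof.
pose p1 := q * ((s - 2) / s); pose p2 := q * ((s - 2) / 2); pose p := Rmin p1 2.
have hq0 : 0 < q.
  have h : 0 < (s - 2) / s by apply: Rdiv_lt_0_compat; lra.
  by nra.
have hp12 : p1 <= p2.
  rewrite /p1 /p2; apply: Rmult_le_compat_l; first lra.
  by apply: Rmult_le_compat_l; [lra | apply: Rinv_le_contravar; lra].
have hp : 1 < p <= 2 by split; [apply: Rmin_glb_lt; [exact: hq | lra] | apply: Rmin_r].
have hpp1 : p <= p1 by apply: Rmin_l.
pose c1 := Rpower M ((s - 2) / s); pose c2 := Rpower M ((s - 2) / 2).
have hc1 : 0 < c1 := Rpower_gt0 _ _; have hc2 : 0 < c2 := Rpower_gt0 _ _.
have gle t : t0 <= t -> 0 <= g t <= Rvi * (c1 * Rpower t (- p1) + c2 * Rpower t (- p2)).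
  move=> ht.
  have r1 := rpow_ge0 (norm (u t)) (s - 2); have r2 := rpow_ge0 (norm (B (u t))) (s - 2).
  have d1 := rpow_decay (a := s) (b := s - 2) ltac:(lra) ltac:(lra) (norm_ge_0 _) M_gt0 (decay_norm ht).
  have d2 : rpow (norm (B (u t))) (s - 2) <= c2 * Rpower t (- p2).
    apply: rpow_decay => //; try lra; first exact: norm_ge_0.
    apply: Rle_trans (decay_sqrt ht).
    rewrite /rpow; case: Rle_dec => h; first exact: pow2_ge_0.
    by rewrite -(Rpower_pow 2) /=; [right; congr Rpower; ring | lra].
  by split; [apply: Rmult_le_pos; lra | apply: Rmult_le_compat_l; rewrite -/c1 -/p1 in d1; lra].
have hsn : 0 < sqrt nu by apply: sqrt_lt_R0.
have hk : 0 < / sqrt nu by apply: Rinv_0_lt_compat.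
have wk t : t0 <= t -> norm (w t) <= / sqrt nu * norm (B (w t)).
  move=> ht; have [o1 _] := coproj_sqrt hP hB (mild_dom mild ht).
  have := gap o1 (coproj_orth hP (u t)); rewrite -/(w t) => hgap.
  have n1 := norm_ge_0 (w t); have n2 := norm_ge_0 (B (w t)).
  apply: (Rmult_le_reg_l (sqrt nu)) => //.
  rewrite -Rmult_assoc Rinv_r ?Rmult_1_l; last lra.
  have hs2 : sqrt nu * sqrt nu = nu by apply: sqrt_sqrt; lra.
  have hsw : 0 <= sqrt nu * norm (w t) by apply: Rmult_le_pos; lra.
  case: (Rle_dec (sqrt nu * norm (w t)) (norm (B (w t)))) => // hn; exfalso.
  have hn' : norm (B (w t)) < sqrt nu * norm (w t) by lra.
  have : norm (B (w t)) ^ 2 < (sqrt nu * norm (w t)) ^ 2 by nra.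
  have -> : (sqrt nu * norm (w t)) ^ 2 = sqrt nu * sqrt nu * norm (w t) ^ 2 by ring.
  by rewrite hs2; lra.
have eBw t : t0 <= t -> B (w t) = B (u t).
  by move=> ht; have [_ h] := coproj_sqrt hP hB (mild_dom mild ht).
have wweak := weak_solution_coproj hB hP weak.
pose en t := / 2 * norm (dw t) ^ 2 + / 2 * norm (B (w t)) ^ 2.
pose g0 := Rvi * (c1 * Rpower t0 (- p1) + c2 * Rpower t0 (- p2)).
have cen r : continuous (clamp t0 en) r.
  have cdw : continuous (clamp t0 dw) r.
    exact: (filterlim_coproj hP (clamp_velocity_continuous mild r)).
  have cbw : continuous (clamp t0 (fun t => B (w t))) r.
    apply: (filterlim_ext (clamp t0 (fun t => B (u t)))).
      by move=> x; rewrite /clamp eBw //; apply: Rmax_l.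
    rewrite [clamp _ _ r]/clamp eBw; last exact: Rmax_l.
    exact: (clamp_sqrt_continuous hB mild r).
  have sq (v : R -> H) : continuous (clamp t0 v) r ->
      continuous (fun r => / 2 * norm (clamp t0 v r) ^ 2) r.
    move=> cv; apply: filterlim_Rmult; first exact: filterlim_const.
    apply: (filterlim_ext (fun r => inner (clamp t0 v r) (clamp t0 v r))).
      by move=> x; rewrite inner_norm.
    by rewrite -inner_norm; apply: filterlim_inner.
  by apply: filterlim_Rplus; [exact: (sq _ cdw) | exact: (sq _ cbw)].
have den t : t0 < t -> is_derive en t (- (alpha / t) * norm (dw t) ^ 2 - inner (f t) (dw t)).
  move=> ht; have := energy_derivative sB wweak ht; congr is_derive.
  by rewrite coproj_forcing inner_plus_l inner_scal_l inner_norm /dw /=; ring.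
have dwy t : t0 < t -> is_derive (fun t => inner (w t) (dw t)) t
    (norm (dw t) ^ 2 - norm (B (w t)) ^ 2 - alpha / t * inner (w t) (dw t) - inner (f t) (w t)).
  move=> ht; have := position_velocity_derivative wweak ht; congr is_derive.
  by rewrite coproj_forcing inner_plus_l inner_scal_l (inner_sym (dw t)) /dw /w /=; ring.
have [e_pos [c [T [hc [hT low]]]]] : (forall t, t0 <= t -> 0 < en t) /\
    exists c T, 0 < c /\ t0 <= T /\ forall t, T <= t -> c * Rpower t (- alpha) <= en t.
  have pw t : t0 <= t -> 0 <= norm (dw t) ^ 2 /\ 0 <= norm (B (w t)) ^ 2 /\
      Rabs (inner (w t) (dw t)) <= / sqrt nu * en t /\
      Rabs (inner (f t) (dw t)) <= g t * en t /\
      Rabs (inner (f t) (w t)) <= 2 * / sqrt nu * g t * en t.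
    move=> ht; have hw := wk t ht; have [g1 _] := gle t ht.
    have hf : norm (f t) <= g t * norm (B (w t)).
      by rewrite eBw //; apply: F_range; exact: (mild_dom mild ht).
    have n1 := norm_ge_0 (w t); have n2 := norm_ge_0 (dw t); have n3 := norm_ge_0 (B (w t)).
    have n4 := norm_ge_0 (f t).
    have amgm : norm (B (w t)) * norm (dw t) <= en t.
      by rewrite /en; have := pow2_ge_0 (norm (B (w t)) - norm (dw t)); lra.
    have half : norm (B (w t)) * norm (B (w t)) <= 2 * en t.
      by rewrite /en; have := pow2_ge_0 (norm (dw t)); lra.
    split; first exact: pow2_ge_0.
    split; first exact: pow2_ge_0.
    split; last split.
    - apply: Rle_trans (cauchy_schwarz _ _) _.
      apply: (Rle_trans _ (/ sqrt nu * (norm (B (w t)) * norm (dw t)))).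
        by rewrite -Rmult_assoc; apply: Rmult_le_compat_r.
      by apply: Rmult_le_compat_l; lra.
    - apply: Rle_trans (cauchy_schwarz _ _) _.
      apply: (Rle_trans _ (g t * (norm (B (w t)) * norm (dw t)))).
        by rewrite -Rmult_assoc; apply: Rmult_le_compat_r.
      by apply: Rmult_le_compat_l; lra.
    - apply: Rle_trans (cauchy_schwarz _ _) _.
      apply: (Rle_trans _ (g t * norm (B (w t)) * (/ sqrt nu * norm (B (w t))))).
        by apply: Rmult_le_compat.
      have -> : g t * norm (B (w t)) * (/ sqrt nu * norm (B (w t)))
        = / sqrt nu * g t * (norm (B (w t)) * norm (B (w t))) by ring.
      have -> : 2 * / sqrt nu * g t * en t = / sqrt nu * g t * (2 * en t) by ring.
      by apply: Rmult_le_compat_l => //; apply: Rmult_le_pos; lra.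
  have gb t : t0 <= t -> 0 <= g t <= g0.
    move=> ht; have [g1 g2] := gle t ht; split => //; apply: (Rle_trans _ _ _ g2).
    apply: Rmult_le_compat_l; first lra.
    have m1 : Rpower t (- p1) <= Rpower t0 (- p1) by apply: Rpower_le_antitone; lra.
    have m2 : Rpower t (- p2) <= Rpower t0 (- p2) by apply: Rpower_le_antitone; lra.
    by apply: Rplus_le_compat; apply: Rmult_le_compat_l; lra.
  have gd t : t0 <= t -> 1 <= t -> g t <= Rvi * (c1 + c2) * Rpower t (- p).
    move=> ht h1; have [_ g2] := gle t ht; apply: (Rle_trans _ _ _ g2).
    rewrite Rmult_assoc; apply: Rmult_le_compat_l; first lra.
    have mono a b : a <= b -> Rpower t a <= Rpower t b.
      move=> hab; case: (Req_dec t 1) => [->|ht1]; last by apply: Rle_Rpower; lra.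
      by rewrite /Rpower ln_1 !Rmult_0_r; lra.
    have m1 : Rpower t (- p1) <= Rpower t (- p) by apply: mono; lra.
    have m2 : Rpower t (- p2) <= Rpower t (- p) by apply: mono; lra.
    rewrite Rmult_plus_distr_r.
    by apply: Rplus_le_compat; apply: Rmult_le_compat_l; lra.
  have hCg : 0 <= Rvi * (c1 + c2) by apply: Rmult_le_pos; lra.
  split.
    move=> t ht.
    exact: (oscillation_energy_pos t0_gt0 alpha_gt0 cen den pw gb oscillation_initial_energy ht).
  exact: (oscillation_lower_bound t0_gt0 alpha_gt0 (Rlt_le _ _ hk) hp hCg cen den dwy pw gb gd
    oscillation_initial_energy).
have en_le t : t0 <= t -> en t <= energy B F u du t.
  move=> ht; rewrite /en /energy eBw //.
  have h1 := coproj_norm hP (du t); have h2 := norm_ge_0 (coproj P (du t)).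
  have h3 := F_ge0 (mild_dom mild ht).
  have : norm (dw t) ^ 2 <= norm (du t) ^ 2 by rewrite /dw; nra.
  lra.
exists c, T; split => //; split => //; split.
  by apply: Rlt_le_trans (en_le _ hT); apply: e_pos.
by move=> t ht; apply: (Rle_trans _ _ _ (low t ht)); apply: en_le; lra.
Qed.

(** Before the asymptotic regime the energy is bounded below because it is
    non-increasing. *)
Lemma energy_lower_bound : exists c, 0 < c /\
  forall t, t0 <= t -> energy B F u du t >= c * Rpower t (- alpha).
Proof.
have [c [T [hc [hT [hE low]]]]] := oscillation_energy_lower.
pose d := energy B F u du T * Rpower t0 alpha.
have hd : 0 < d by apply: Rmult_lt_0_compat => //; apply: Rpower_gt0.
exists (Rmin c d); split; first exact: Rmin_glb_lt.
move=> t ht; apply: Rle_ge; have hpt := Rpower_gt0 t (- alpha).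
case: (Rle_lt_dec T t) => hTt.
  apply: (Rle_trans _ _ _ _ (low t hTt)).
  by apply: Rmult_le_compat_r; [lra | apply: Rmin_l].
have htT : t0 <= t <= T by lra.
apply: (Rle_trans _ _ _ _ (energy_nonincreasing htT)).
apply: (Rle_trans _ (d * Rpower t (- alpha))).
  by apply: Rmult_le_compat_r; [lra | apply: Rmin_r].
have h1 : Rpower t (- alpha) <= Rpower t0 (- alpha) by apply: Rpower_le_antitone; lra.
have h2 : Rpower t0 alpha * Rpower t0 (- alpha) = 1.
  by rewrite -Rpower_plus Rplus_opp_r Rpower_O.
have h3 := Rmult_le_compat_l d _ _ (Rlt_le _ _ hd) h1.
have h4 : d * Rpower t0 (- alpha) = energy B F u du T by rewrite /d Rmult_assoc h2; ring.
lra.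
Qed.

End Oscillation.

End Solution.

Theorem theorem4p8
  (H : HilbertSpace) (A sqrtA : operator H) (P : H -> H) (S dS : R -> H -> H)
  (F : H -> R) (gradF : H -> H) (s nu alpha Rvi L1 : R)
  (L0 : R -> R -> R) (M0 : R -> R)
  (hA : nonneg_self_adjoint A)
  (hsqrtA : is_sqrt_operator A sqrtA)
  (hP : is_orth_projection (ker A) P)
  (hS : is_solution_operator A sqrtA S dS)
  (A_neq0 : exists x, dom A x /\ A x <> zero)
  (nu_gt0 : 0 < nu)
  (gap : forall u, dom sqrtA u -> orth (ker A) u ->
     norm (sqrtA u) ^ 2 >= nu * norm u ^ 2)
  (* (i) *)
  (F_ge0 : forall u, dom sqrtA u -> 0 <= F u)
  (F_0 : F zero = 0)
  (F_grad : has_gradient sqrtA F gradF)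
  (* (ii) *)
  (L0_gt0 : forall a b, 0 <= a -> 0 <= b -> 0 < L0 a b)
  (L0_bounded : forall r, exists M, forall a b,
     0 <= a <= r -> 0 <= b <= r -> L0 a b <= M)
  (F_lip : forall v w, dom sqrtA v -> dom sqrtA w ->
     norm (minus (gradF v) (gradF w))
       <= L0 (norm1 sqrtA v) (norm1 sqrtA w) * norm1 sqrtA (minus v w))
  (* (iii) *)
  (s_gt2 : 2 < s)
  (F_superlinear : forall u, dom sqrtA u -> s * F u <= inner (gradF u) u)
  (* (iv) *)
  (L1_gt0 : 0 < L1)
  (F_growth : forall v w, dom sqrtA v -> dom sqrtA w ->
     norm (minus (gradF v) (gradF w))
       <= L1 * norm1 sqrtA (minus v w)
          * (rpow (norm1 sqrtA v) (s - 2) + rpow (norm1 sqrtA w) (s - 2)))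
  (* (v) *)
  (M0_bounded : bounded_on_bounded_sets M0)
  (F_coercive : forall u, dom sqrtA u ->
     rpow (norm u) s
       <= M0 (norm (sqrtA u)) * (norm (sqrtA u) ^ 2 + F u))
  (* (vi) *)
  (Rvi_gt0 : 0 < Rvi)
  (F_range : forall u, dom sqrtA u ->
     norm (minus (gradF u) (P (gradF u)))
       <= Rvi * (rpow (norm u) (s - 2) + rpow (norm (sqrtA u)) (s - 2))
          * norm (sqrtA u))
  (h_alpha :
     (2 < alpha <= 2 * s / (s - 2) /\ 6 < s) \/
     ((s + 2) / (s - 2) < alpha <= 2 * s / (s - 2) /\ s <= 6))
  (eps K : R)
  (h_eps : 0 < eps < Rmin (1 / (4 * (s - 2))) (1 / 2))
  (K_gt0 : 0 < K) :
  let C1 := Rpower 2 (s / 2) * Rvi * (Rpower K ((s - 2) / s) + 1) in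
  let C3 := (8 * nu + 8) / nu * C1 in
  exists Ceps : R, 0 < Ceps /\
  forall (eps1 t0 : R) (u0 u1 : H) (u du : R -> H),
    0 < eps1 <= Rmin (1 / s ^ 2) ((s - 2) / (2 * s ^ 2 + 3 * s + 2)) ->
    0 < t0 ->
    dom sqrtA u0 ->
    ~ (ker A u0 /\ ker A u1) ->
    is_mild_solution sqrtA S dS gradF (fun t => alpha / t) t0 u0 u1 u du ->
    (forall r, 0 <= r <= sqrt (2 * energy sqrtA F u du t0) -> M0 r <= K) ->
    let Hs := H_star sqrtA F alpha u du t0 in
    let Ht := H_star_tilde sqrtA F alpha eps u du t0 in
    let Ct0 := Ceps * Rpower t0 (alpha - 2 * s / (s - 2) - 2 * eps) in
    (forall t, t0 <= t ->
       F (u t) + norm (sqrtA (u t)) ^ 2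
         <= 4 * Ht * Rpower t (- alpha + 2 * eps)
            + Ct0 * Rpower t (- alpha + 2 * eps)) /\
    (forall t7, t0 <= t7 ->
       t7 ^ 2 >= Rmax (alpha / nu * Rabs (alpha - 1))
                      (alpha / (2 * nu) * Rabs (alpha / 2 + 1)) ->
       t7 >= (nu ^ 2 + 2 * nu + 3) / (nu * eps1) * alpha
             + rpow (4 * C1 / (eps1 * alpha)
                     * (rpow (pos_part Hs) ((s - 2) / s)
                        + rpow (pos_part Hs) ((s - 2) / 2))) (s / 2)
             + Rpower (8 * C1 / (eps1 * alpha)) s
               * rpow (pos_part (Ht + Ct0)) (s - 2) ->
       t7 >= rpow (pos_part (2 * Ht)) ((s + 2) / alpha)
             + Rpower (2 * Ct0) (s * (s + 2) / (2 * alpha))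
             + Rpower (16 * s * C3) (2 * s)
             + 4 * sqrt (2 * nu + 2) / nu ->
       exists c : R, 0 < c /\
         forall t, t7 <= t -> energy sqrtA F u du t >= c * Rpower t (- alpha)).
Proof.
move=> C1 C3.
have s_gt2' : 0 < s - 2 by lra.
have alpha_gt0 : 0 < alpha.
  case: h_alpha => [[h _]|[[h _] _]]; first lra.
  by have : 0 < (s + 2) / (s - 2) by [apply: Rdiv_lt_0_compat; lra]; lra.
have alpha_le : alpha <= 2 * s / (s - 2) by case: h_alpha; lra.
have eps1 := Rmin_l (1 / (4 * (s - 2))) (1 / 2).
have [C [hC upper]] := upper_estimate s_gt2 alpha_gt0 alpha_le (proj1 h_eps) K_gt0.
exists C; split => //.
move=> e1 t0 u0 u1 u du _ t0_gt0 hu0 data mild hK Hs Ht Ct0.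
have [sA _] := hA.
have bound t : t0 <= t ->
    F (u t) + norm (sqrtA (u t)) ^ 2
      <= 4 * Ht * Rpower t (- alpha + 2 * eps) + Ct0 * Rpower t (- alpha + 2 * eps).
  move=> ht.
  have := upper t0 (fun t => norm (u t) ^ 2) (fun t => inner (u t) (du t))
    (fun t => norm (du t) ^ 2) (fun t => norm (sqrtA (u t)) ^ 2) (fun t => F (u t))
    (fun t => inner (gradF (u t)) (u t)) (fun t => norm (u t)) t0_gt0
    (position_clamp_continuous mild) (cross_clamp_continuous mild)
    (energy_clamp_continuous hsqrtA F_grad L0_bounded F_lip mild) _
    (@cross_derive _ _ _ _ _ _ _ _ _ _ _ _ _ sA hsqrtA hS L0_bounded F_lip t0_gt0 hu0 mild)
    (@energy_derive _ _ _ _ _ _ _ _ _ _ _ _ _ _ sA hsqrtA hS F_grad L0_bounded F_lip t0_gt0 hu0 mild) _ t ht.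
  have -> : lyapunov alpha eps (fun t => norm (u t) ^ 2) (fun t => inner (u t) (du t))
    (fun t => norm (du t) ^ 2) (fun t => norm (sqrtA (u t)) ^ 2) (fun t => F (u t)) t0
    = energy_lambda sqrtA F alpha (alpha / 2 + eps) u du t0 by rewrite energy_lambdaE.
  apply.
  - move=> r hr; have [_ [dr _]] := mild_weak sA hsqrtA hS L0_bounded F_lip t0_gt0 hu0 mild hr.
    have := is_derive_norm_sq dr; congr is_derive.
    by rewrite (inner_sym (du r)).
  - move=> r hr; have hd := mild_dom mild hr.
    split; first exact: norm_ge_0.
    split => //; split; first exact: pow2_ge_0.
    split; first exact: F_ge0.
    split; first exact: F_superlinear.
    split.
      apply: (Rle_trans _ _ _ (F_coercive _ hd)).
      apply: Rmult_le_compat_r.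
        by have := pow2_ge_0 (norm (sqrtA (u r))); have := F_ge0 _ hd; lra.
      apply: hK; split; first exact: norm_ge_0.
      exact: (sqrt_bounded_by_energy sA hsqrtA hS F_ge0 F_grad L0_bounded F_lip alpha_gt0 t0_gt0 hu0 mild hr).
    have := pow2_ge_0 (norm (plus (scal (alpha / 2 + eps) (u r)) (scal r (du r)))).
    rewrite -(inner_norm (plus _ _)); inner_expand.
    rewrite (inner_sym (du r) (u r)) !inner_norm; lra.
split => // t7 ht7 _ _ _.
(* real powers of M are taken below, so M has to be positive *)
pose M := Rabs (4 * Ht + Ct0) + 1.
have hM : 0 < M by have := Rabs_pos (4 * Ht + Ct0); rewrite /M; lra.
have decay t : t0 <= t -> F (u t) + norm (sqrtA (u t)) ^ 2 <= M * Rpower t (- (alpha - 2 * eps)).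
  move=> ht; apply: (Rle_trans _ _ _ (bound t ht)).
  have -> : - (alpha - 2 * eps) = - alpha + 2 * eps by ring.
  rewrite -Rmult_plus_distr_r; apply: Rmult_le_compat_r; first by left; apply: Rpower_gt0.
  by have := Rle_abs (4 * Ht + Ct0); rewrite /M; lra.
(* the factor K + 1 makes one bound serve for both norms *)
have hKM : 0 < (K + 1) * M by apply: Rmult_lt_0_compat; lra.
have hq : 1 < (alpha - 2 * eps) * ((s - 2) / s).
  by apply: decay_exponent => //; [case: h_alpha; tauto | lra].
have dn t : t0 <= t -> rpow (norm (u t)) s <= (K + 1) * M * Rpower t (- (alpha - 2 * eps)).
  move=> ht; have hd := mild_dom mild ht.
  have hm := sqrt_bounded_by_energy sA hsqrtA hS F_ge0 F_grad L0_bounded F_lip alpha_gt0 t0_gt0 hu0 mild ht.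
  have hG : 0 <= norm (sqrtA (u t)) ^ 2 + F (u t).
    by have := pow2_ge_0 (norm (sqrtA (u t))); have := F_ge0 _ hd; lra.
  apply: (Rle_trans _ _ _ (F_coercive _ hd)).
  apply: (Rle_trans _ ((K + 1) * (norm (sqrtA (u t)) ^ 2 + F (u t)))).
    apply: Rmult_le_compat_r => //.
    by have := hK _ (conj (norm_ge_0 _) hm); lra.
  by rewrite Rmult_assoc; apply: Rmult_le_compat_l; [lra | have := decay t ht; lra].
have ds t : t0 <= t -> norm (sqrtA (u t)) ^ 2 <= (K + 1) * M * Rpower t (- (alpha - 2 * eps)).
  move=> ht; have := decay t ht; have := F_ge0 _ (mild_dom mild ht).
  have := Rmult_lt_0_compat _ _ hM (Rpower_gt0 t (- (alpha - 2 * eps))).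
  by nra.
have [c [hc low]] := energy_lower_bound sA hsqrtA hS F_ge0 F_grad L0_bounded F_lip alpha_gt0
  t0_gt0 hu0 mild hP nu_gt0 s_gt2 gap Rvi_gt0 F_range data hKM hq dn ds.
by exists c; split => // t ht; apply: low; lra.
Qed.
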